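(* Let $P$ be an abelian lattice ordered semigroup inside a group $G$, let $\mathcal{H}$ be a Hilbert space, and let $T:P\to\mathcal{B}(\mathcal{H})$ be a contractive representation. Let $P^\infty$ be the abelian lattice ordered semigroup of finitely supported sequences in $P$, inside the group $G^\infty$ of finitely supported sequences in $G$, and let $T^\infty:P^\infty\to\mathcal{B}(\mathcal{H})$ be the representation determined by $T^\infty(p\otimes\delta_n)=T(p)$ for all $p\in P$ and all $n$. Then the following are equivalent: (i) There exist a Hilbert space $\mathcal{K}\supseteq\mathcal{H}$ and a contractive normal representation $N:P\to\mathcal{B}(\mathcal{K})$ such that $T(p)=N(p)|_{\mathcal{H}}$ for all $p\in P$. (ii) $T^\infty$ is regular.
   Context: Lattice ordered semigroups: Let $P$ be a unital subsemigroup of a group $G$ with $P\cap P^{-1}=\{e\}$, $G=P^{-1}P$ and $P$ normal in $G$ (i.e. $gPg^{-1}\subseteq P$ for all $g\in G$; automatic when $G$ is abelian). Then $x\le y \iff x^{-1}y\in P$ is a partial order on $G$. $P$ is a lattice ordered semigroup inside $G$ if any two elements $g,h\in G$ have a least upper bound $g\vee h$ and a greatest lower bound $g\wedge h$. In that case every $g\in G$ can be written uniquely as $g=g_-^{-1}g_+$ with $g_+,g_-\in P$ and $g_+\wedge g_-=e$. Representations: A representation of $P$ on $\mathcal{H}$ is a map $T:P\to\mathcal{B}(\mathcal{H})$ with $T(e)=I$ and $T(pq)=T(p)T(q)$. It is contractive if $\|T(p)\|\le1$ for all $p$, and normal if every $T(p)$ is a normal operator. Regularity: A representation $T:P\to\mathcal{B}(\mathcal{H})$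 of a lattice ordered semigroup $P$ inside $G$ is regular if there are a Hilbert space $\mathcal{K}\supseteq\mathcal{H}$ and a unitary representation $U:G\to\mathcal{B}(\mathcal{K})$ such that $T(g_-)^*T(g_+)=P_{\mathcal{H}}U(g)|_{\mathcal{H}}$ for every $g\in G$, where $P_{\mathcal{H}}$ is the orthogonal projection of $\mathcal{K}$ onto $\mathcal{H}$. The semigroup $P^\infty$: For abelian $P$ inside $G$, $P^\infty$ (resp. $G^\infty$) is the set of sequences $(p_i)_{i\ge1}$ in $P$ (resp. $G$) with $p_i=e$ for all but finitely many $i$, with coordinatewise operation; $p\otimes\delta_n$ denotes the sequence with $p$ in position $n$ and $e$ elsewhere. $P^\infty$ is a lattice ordered semigroup inside $G^\infty$, with lattice operations computed coordinatewise. Explicitly, $T^\infty((p_i)_i)=\prod_i T(p_i)$. *)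

(* Defs.v *)
From HB Require Import structures.
From mathcomp Require Import all_boot all_order all_algebra finmap.
From mathcomp Require Import all_classical reals topology normedtype.
From mathcomp Require Import complex ring.

Set Implicit Arguments.
Unset Strict Implicit.
Unset Printing Implicit Defensive.

Import Order.TTheory GRing.Theory Num.Theory.
Import numFieldNormedType.Exports.

Local Open Scope classical_set_scope.
Local Open Scope ring_scope.

(* The inner product is linear in its first argument and conjugate-linear in
   the second. *)
HB.mixin Record NormedModule_isHilbert (R : realType) H
    & CompleteNormedModule R[i] H := {
  hdot : {dot H for @Num.conj R[i]} ;
  hdot_norm : forall x : H, hdot x x = `|x| ^+ 2
}.

#[short(type="hilbertType")]
HB.structure Definition Hilbert (R : realType) :=
  {H of CompleteNormedModule R[i] H & NormedModule_isHilbert R H}.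

Notation "''[' x , y ]" := (hdot x y) : ring_scope.

Section InnerProduct.
Variables (R : realType) (H : hilbertType R).
Implicit Types x y z : H.

Lemma hdotC x y : '[x, y] = '[y, x]^*.
Proof. by rewrite (hermC (@hdot R H)) expr0 mul1r. Qed.
Lemma hdotDl x y z : '[x + y, z] = '[x, z] + '[y, z].
Proof. exact: linearDl. Qed.
Lemma hdotDr x y z : '[x, y + z] = '[x, y] + '[x, z].
Proof. exact: linearD. Qed.
Lemma hdotBl x y z : '[x - y, z] = '[x, z] - '[y, z].
Proof. exact: linearBl. Qed.
Lemma hdotBr x y z : '[x, y - z] = '[x, y] - '[x, z].
Proof. exact: linearB. Qed.
Lemma hdotZl (a : R[i]) x y : '[a *: x, y] = a * '[x, y].
Proof. exact: linearZl_LR. Qed.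
Lemma hdotZr (a : R[i]) x y : '[x, a *: y] = a^* * '[x, y].
Proof. exact: linearZr_LR. Qed.

Lemma hnorm0 x : '[x, x] = 0 -> x = 0.
Proof.
by move/eqP; rewrite hdot_norm expf_eq0 /= normr_eq0 => /eqP.
Qed.

Lemma hdot_ext x y : (forall z, '[x, z] = '[y, z]) -> x = y.
Proof.
move=> e; apply/eqP; rewrite -subr_eq0; apply/eqP/hnorm0.
by rewrite hdotBl e subrr.
Qed.

Lemma hdot_extr x y : (forall z, '[z, x] = '[z, y]) -> x = y.
Proof. by move=> e; apply: hdot_ext => z; rewrite hdotC e -hdotC. Qed.

Lemma hnormDE x y : `|x + y| ^+ 2 = `|x| ^+ 2 + `|y| ^+ 2 + ('[x, y] + '[x, y]^*).
Proof.
rewrite -!hdot_norm hdotDl !hdotDr -(hdotC y x).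
set a := '[x, x]; set b := '[y, y]; set c := '[x, y]; set d := c^*.
by ring.
Qed.

Lemma hnormBE x y : `|x - y| ^+ 2 = `|x| ^+ 2 + `|y| ^+ 2 - ('[x, y] + '[x, y]^*).
Proof.
by rewrite hnormDE normrN -scaleN1r hdotZr rmorphN rmorph1 mulN1r rmorphN opprD.
Qed.

Lemma hdot_bound x y : `|'[x, y]| <= `|x| * `|y|.
Proof.
have [->|x0] := eqVneq x 0.
  by rewrite normr0 mul0r -(scale0r 0) hdotZl mul0r normr0.
have nx : `|x| != 0 :> R[i] by rewrite normr_eq0.
have nxgt0 : 0 < `|x| :> R[i] by rewrite normr_gt0.
rewrite -[leLHS]norm_conjC -hdotC.
set a := '[y, x].
have h : 0 <= `|y - (a / `|x| ^+ 2) *: x| ^+ 2 :> R[i] by rewrite exprn_ge0.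
have c : (`|x| ^+ 2)^-1^* = (`|x| ^+ 2)^-1 :> R[i].
  by apply: CrealP; rewrite realV realX// normr_real.
move: h; rewrite hnormBE normrZ exprMn hdotZr normrM exprMn normfV normrX normr_id.
rewrite rmorphM /= c -/a (mulrAC a^*) [a^* * a]mulrC -normCK rmorphM /= c.
rewrite rmorphXn /= (CrealP (normr_real _)).
set b := `|a|; set u := `|x|; set v := `|y| => h.
have vb : 0 <= (v * u) ^+ 2 - b ^+ 2.
  have := mulr_ge0 (exprn_ge0 2 (ltW nxgt0)) h.
  by congr (0 <= _); rewrite -/u; field.
have : b ^+ 2 <= (u * v) ^+ 2 by rewrite -subr_ge0 (mulrC u).
by rewrite ler_sqr ?nnegrE ?mulr_ge0 ?normr_ge0.
Qed.

End InnerProduct.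

Section Riesz.
Variables (R : realType) (H : hilbertType R) (phi : H -> R[i]) (M : R[i]).
Hypothesis phiD : forall x y, phi (x + y) = phi x + phi y.
Hypothesis phiZ : forall a x, phi (a *: x) = a * phi x.
Hypothesis phiM : forall x, `|phi x| <= M * `|x|.

Let q x : R[i] := `|x| ^+ 2 - (phi x + (phi x)^*).

Let q_real x : q x \is Num.real.
Proof.
rewrite /q realB// ?realX ?normr_real//.
by apply/CrealP; rewrite rmorphD/= conjCK addrC.
Qed.

Let qE x : (complex.Re (q x))%:C%C = q x.
Proof. exact: RRe_real (q_real x). Qed.

Let M_ge0 : (exists x : H, x != 0) -> 0 <= M.
Proof.
move=> [x x0]; have : 0 <= M * `|x| by apply: le_trans (phiM x); rewrite normr_ge0.
by rewrite pmulr_lge0 ?normr_gt0.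
Qed.

Lemma riesz : exists y, forall x, phi x = '[x, y].
Proof.
have [[x0 x0P]|nx] := pselect (exists x : H, x != 0); last first.
  exists 0 => x; have -> : x = 0 by apply: contrapT => /eqP xN; apply: nx; exists x.
  by rewrite -(scale0r 0) phiZ hdotZl !mul0r.
have M0 : 0 <= M by apply: M_ge0; exists x0.
have q_lb x : - M ^+ 2 <= q x.
  rewrite -subr_ge0 opprK /q.
  have h : phi x + (phi x)^* <= 2 * (M * `|x|).
    have := (leif_Re_Creal (phi x)).1; rewrite ReE ler_pdivrMr// mulrC => /le_trans.
    by apply; rewrite ler_pM2l// phiM.
  apply: le_trans (_ : 0 <= (`|x| - M) ^+ 2) _.
    by rewrite real_exprn_even_ge0// realB ?normr_real ?ger0_real.
  set u := `|x| in h *; set w := _ + _^* in h *.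
  rewrite -subr_ge0.
  have -> : u ^+ 2 - w + M ^+ 2 - (u - M) ^+ 2 = 2 * (M * u) - w by ring.
  by rewrite subr_ge0.
pose S : set R := range (fun x => complex.Re (q x)).
have SlB : has_inf S.
  split; first by exists (complex.Re (q 0)), 0.
  exists (complex.Re (- M ^+ 2)) => _ [x _ <-].
  by have := q_lb x; rewrite lecE => /andP[].
pose m := inf S.
have mq x : m%:C%C <= q x.
  by rewrite -qE lecR; apply: ge_inf; [exact: SlB.2|exists x].
have mlt (e : R) : 0 < e -> exists x, q x < (m + e)%:C%C.
  by move=> /(inf_adherent)/(_ SlB)[_ [x _ <-]] h; exists x; rewrite -qE ltcR.
pose A (e : R) := [set x | q x < (m + e)%:C%C].
have q2 x y : `|x - y| ^+ 2 = 2 * q x + 2 * q y - 4 * q (2^-1 *: (x + y)).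
  have n2 : (2 : R[i]) != 0 by rewrite pnatr_eq0.
  rewrite /q phiZ phiD normrZ exprMn hnormBE hnormDE.
  rewrite rmorphM rmorphD fmorphV /= conjC_nat normfV normr_nat.
  set a := phi x; set b := phi y; set c := '[x, y].
  set a' := a^*; set b' := b^*; set c' := c^*.
  by field.
have cl x y (d : R) : A d x -> A d y -> `|x - y| ^+ 2 <= (4 * d)%:C%C.
  move=> Ax Ay; rewrite q2.
  have -> : (4 * d)%:C%C = 2 * (m + d)%:C%C + 2 * (m + d)%:C%C - 4 * m%:C%C.
    by rewrite rmorphM rmorph_nat (rmorphD _ m d); ring.
  by rewrite !lerD ?ler_pM2l ?(ltW Ax) ?(ltW Ay)// lerN2 ler_pM2l.
have err x h (d : R) : A d x -> `|phi h - '[h, x]| ^+ 2 <= d%:C%C * `|h| ^+ 2.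
  move=> Ax; have [->|h0] := eqVneq h 0.
    by rewrite -(scale0r 0) phiZ hdotZl !mul0r subrr normrZ normr0 mul0r expr0n mulr0.
  set e := phi h - '[h, x].
  have u0 : 0 < `|h| ^+ 2 :> R[i] by rewrite exprn_gt0// normr_gt0.
  have c : ((`|h| ^+ 2)^-1)^* = (`|h| ^+ 2)^-1 :> R[i].
    by apply: CrealP; rewrite realV realX// normr_real.
  have E : q (x + (e^* / `|h| ^+ 2) *: h) = q x - `|e| ^+ 2 / `|h| ^+ 2.
    rewrite /q phiD phiZ hnormDE hdotZr normrZ exprMn normrM exprMn normfV normrX.
    rewrite normr_id norm_conjC (hdotC x h).
    rewrite !(rmorphM, rmorphD) /= !c !conjCK normCK /e !(rmorphD, rmorphN) /=.
    set a := phi x; set b := phi h; set g := '[h, x].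
    set a' := a^*; set b' := b^*; set g' := g^*; set v := `|h|.
    have v0 : v != 0 by rewrite normr_eq0.
    by field.
  have := mq (x + (e^* / `|h| ^+ 2) *: h); rewrite E lerBrDr => mm.
  rewrite -ler_pdivrMr// -(lerD2l m%:C%C); apply: le_trans mm _.
  by rewrite -rmorphD; exact: ltW.
pose F := filter_from [set e : R | 0 < e] A.
have FF : ProperFilter F.
  apply: filter_from_proper; last by move=> e /mlt[x qx]; exists x.
  apply: filter_from_filter; first by exists 1 => /=.
  move=> i j i0 j0; exists (Num.min i j); first by rewrite /= lt_min i0.
  by move=> x; rewrite /A/= => h; split; apply: lt_le_trans h _;
    rewrite lecR lerD2l ge_min lexx ?orbT.
have FA (d : R) : 0 < d -> F (A d) by move=> d0; exists d.
have epsE (e : R[i]) : 0 < e -> exists2 r : R, 0 < r & e = r%:C%C.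
  move=> e0; exists (complex.Re e); first by move: e0; rewrite ltcE => /andP[].
  by rewrite RRe_real// gtr0_real.
have Fc : cvg F.
  apply: cauchy_cvg; apply: cauchy_exP => _ /epsE[r r0 ->].
  pose d := r ^+ 2 / 8.
  have d0 : 0 < d by rewrite divr_gt0// exprn_gt0.
  have [x Ax] := mlt _ d0; exists x; exists d => //= y Ay.
  rewrite -ball_normE /=.
  have r0c : 0 < r%:C%C :> R[i] by rewrite -(rmorph0 (real_complex R)) ltcR.
  rewrite -ltr_sqr ?nnegrE ?normr_ge0 ?(ltW r0c)//.
  apply: le_lt_trans (cl _ _ _ Ax Ay) _.
  rewrite -rmorphXn ltcR /d mulrCA gtr_pMr ?exprn_gt0// ltr_pdivrMr// mul1r.
  by rewrite ltr_nat.
have [y Fy] : exists y : H, F --> y by apply/cvg_ex.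
exists y => h; apply/eqP; rewrite -subr_eq0 -normr_le0; apply/ler_addgt0Pl => e /epsE[r r0 ->].
rewrite addr0.
pose N := 1 + `|h|.
have N0 : 0 < N by rewrite ltr_pwDl.
have [n n0 NE] := epsE _ N0.
pose s := r / 2 / n.
have s0 : 0 < s by rewrite !divr_gt0.
have sc0 : 0 < s%:C%C :> R[i] by rewrite -(rmorph0 (real_complex R)) ltcR.
have Fb : F (ball y s%:C%C) by apply: Fy; exact: nbhsx_ballx.
have [x [Ax]] := filter_ex (filterI (FA _ (exprn_gt0 2 s0)) Fb).
rewrite -ball_normE /= => yx.
have := err x h _ Ax; rewrite rmorphXn -exprMn ler_sqr ?nnegrE ?mulr_ge0 ?(ltW sc0)// => e1.
have -> : phi h - '[h, y] = phi h - '[h, x] + '[h, x - y] by rewrite hdotBr addrA subrK.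
apply: le_trans (ler_normD _ _) _; apply: le_trans (lerD e1 (hdot_bound _ _)) _.
have e2 : `|h| * `|x - y| <= s%:C%C * `|h|.
  by rewrite mulrC ler_wpM2r// distrC ltW.
apply: le_trans (lerD (lexx _) e2) _.
have -> : r%:C%C = s%:C%C * N + s%:C%C * N.
  rewrite NE -rmorphM -rmorphD /s; congr (_%:C%C).
  by rewrite divfK ?gt_eqF// -splitr.
by rewrite lerD// ler_pM2l// /N lerDr.
Qed.

End Riesz.

Record bop (R : realType) (H K : hilbertType R) := BOp {
  bop_fun :> H -> K ;
  bop_linear : linear bop_fun ;
  bop_continuous : continuous bop_fun
}.

Notation "''B' ( H , K )" := (bop H K) (format "''B' ( H ,  K )") : type_scope.
Notation "''B' ( H )" := (bop H H) (format "''B' ( H )") : type_scope.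

HB.instance Definition _ (R : realType) (H K : hilbertType R) (A : 'B(H, K)) :=
  GRing.isLinear.Build R[i] H K _ (bop_fun A) (bop_linear A).

HB.instance Definition _ (R : realType) (H K : hilbertType R) :=
  gen_eqMixin 'B(H, K).
HB.instance Definition _ (R : realType) (H K : hilbertType R) :=
  gen_choiceMixin 'B(H, K).

Section BoundedOperators.
Variable R : realType.
Implicit Types H K L : hilbertType R.

Lemma bopP H K (A B : 'B(H, K)) : (forall x, A x = B x) <-> A = B.
Proof.
split=> [e|-> //]; case: A B e => [f fl fc] [g gl gc] /= /funext e.
by case: _ / e gl gc => gl gc; congr BOp; exact: Prop_irrelevance.
Qed.

Lemma bop_id_linear H : linear (@idfun H).
Proof. by []. Qed.

Lemma bop_id_continuous H : continuous (@idfun H).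
Proof. by move=> x; exact: cvg_id. Qed.

Definition bop_id H : 'B(H) := BOp (@bop_id_linear H) (@bop_id_continuous H).

Lemma bop_comp_linear H K L (A : 'B(K, L)) (B : 'B(H, K)) : linear (A \o B).
Proof. by move=> a x y; rewrite /= !linearP. Qed.

Lemma bop_comp_continuous H K L (A : 'B(K, L)) (B : 'B(H, K)) :
  continuous (A \o B).
Proof.
by move=> x; apply: continuous_comp; [apply: (@bop_continuous _ _ _ B)|
  apply: (@bop_continuous _ _ _ A)].
Qed.

Definition bop_comp H K L (A : 'B(K, L)) (B : 'B(H, K)) : 'B(H, L) :=
  BOp (@bop_comp_linear H K L A B) (@bop_comp_continuous H K L A B).

Lemma bop_compA H : associative (@bop_comp H H H).
Proof. by move=> A B C; apply/bopP. Qed.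

Lemma bop_comp1b H : left_id (bop_id H) (@bop_comp H H H).
Proof. by move=> A; apply/bopP. Qed.

Lemma bop_compb1 H : right_id (bop_id H) (@bop_comp H H H).
Proof. by move=> A; apply/bopP. Qed.

Lemma bop_bounded H K (A : 'B(H, K)) :
  exists2 M : R, 0 <= M & forall x, `|A x| <= M%:C%C * `|x|.
Proof.
have /linear_boundedP : bounded_near A (nbhs (0 : H)).
  by apply/linear_bounded_continuous; exact: bop_continuous.
case=> M0 [M0r hM]; pose M : R[i] := `|M0| + 1.
have Mgt : M0 < M by rewrite (le_lt_trans (real_ler_norm M0r))// ltrDl.
have Mge : 0 <= M by rewrite addr_ge0.
exists (complex.Re M); first by move: Mge; rewrite lecE => /andP[].
by rewrite RRe_real ?ger0_real//; apply: hM.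
Qed.

Lemma adj_exists H K (A : 'B(H, K)) :
  exists B : 'B(K, H), forall x y, '[A x, y] = '[x, B y].
Proof.
have [M M0 AM] := bop_bounded A.
have MC0 : 0 <= M%:C%C :> R[i] by rewrite -(rmorph0 (real_complex R)) lecR.
have riesz_A y : exists z, forall x, '[A x, y] = '[x, z].
  apply: (@riesz R H (fun x => '[A x, y]) (M%:C%C * `|y|)) => [x x'|a x|x].
  - by rewrite linearD hdotDl.
  - by rewrite linearZ hdotZl.
  - apply: le_trans (hdot_bound _ _) _.
    by rewrite mulrAC ler_wpM2r.
have [B BE] := choice riesz_A.
have Blin : linear B.
  move=> a y z; apply: hdot_extr => x.
  by rewrite hdotDr hdotZr -!BE hdotDr hdotZr.
pose B' : {linear K -> H} :=
  HB.pack B (GRing.isLinear.Build R[i] K H _ B Blin).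
suff Bc : continuous B by exists (BOp Blin Bc) => x y; rewrite BE.
apply: (@bounded_linear_continuous _ _ _ B'); apply/linear_boundedP.
exists M%:C%C; split=> [|r rM y]; first by rewrite ger0_real.
rewrite -[B' y]/(B y).
have [->|By0] := eqVneq (B y) 0.
  by rewrite normr0 mulr_ge0// (le_trans MC0)// ltW.
have h : `|B y| ^+ 2 <= (r * `|y|) * `|B y| :> R[i].
  rewrite -hdot_norm -BE.
  have A0 : 0 <= '[A (B y), y] by rewrite BE hdot_norm exprn_ge0.
  rewrite -(ger0_norm A0); apply: le_trans (hdot_bound _ _) _.
  rewrite mulrAC ler_wpM2r//; apply: le_trans (AM _) _.
  by rewrite ler_wpM2r// ltW.
by move: h; rewrite expr2 ler_pM2r// normr_gt0.
Qed.

Definition adj H K (A : 'B(H, K)) : 'B(K, H) := projT1 (cid (adj_exists A)).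

Lemma adjP H K (A : 'B(H, K)) x y : '[A x, y] = '[x, adj A y].
Proof. by rewrite /adj; case: cid. Qed.

Lemma adj_unique H K (A : 'B(H, K)) (B : 'B(K, H)) :
  (forall x y, '[A x, y] = '[x, B y]) -> B = adj A.
Proof.
by move=> BE; apply/bopP => y; apply: hdot_extr => x; rewrite -BE adjP.
Qed.

Definition opnorm H K (A : 'B(H, K)) : R :=
  inf [set M | 0 <= M /\ forall x, `|A x| <= M%:C%C * `|x|].

Lemma opnorm_le1 H K (A : 'B(H, K)) :
  opnorm A <= 1 <-> forall x, `|A x| <= `|x|.
Proof.
pose S := [set M : R | 0 <= M /\ forall x, `|A x| <= M%:C%C * `|x|].
have Sinf : has_inf S.
  have [M M0 AM] := bop_bounded A.
  by split; [exists M | exists 0 => N []].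
split=> [A1 x|A1]; last first.
  apply: ge_inf; first by exists 0 => N [].
  by split=> // x; rewrite mul1r.
apply/ler_addgt0Pr => e e0.
have [->|x0] := eqVneq x 0; first by rewrite linear0 !normr0 add0r ltW.
have nx0 : 0 < `|x| :> R[i] by rewrite normr_gt0.
have q0 : 0 < e / `|x| :> R[i] by rewrite divr_gt0.
have eC : (complex.Re (e / `|x|))%:C%C = e / `|x| by rewrite RRe_real// gtr0_real.
have d0 : 0 < complex.Re (e / `|x|) by move: q0; rewrite ltcE => /andP[].
have [M [M0 AM] Mlt] := inf_adherent d0 Sinf.
apply: le_trans (AM x) _.
have -> : `|x| + e = (1 + complex.Re (e / `|x|))%:C%C * `|x|.
  by rewrite rmorphD rmorph1 mulrDl mul1r [X in X * _]eC divfK ?gt_eqF.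
rewrite ler_pM2r// lecR; apply: ltW; apply: lt_le_trans Mlt _.
by rewrite lerD2r.
Qed.

End BoundedOperators.

(* 'B(H) is a monoid for composition: A * B is A \o B and 1 is the identity. *)
HB.instance Definition _ (R : realType) (H : hilbertType R) :=
  isMonoid.Build 'B(H) (@bop_compA R H) (@bop_comp1b R H) (@bop_compb1 R H).

Section OperatorClasses.
Variable R : realType.
Implicit Types H K : hilbertType R.

Definition isometric H K (V : 'B(H, K)) := forall x, `|V x| = `|x|.

Definition normal_op H (A : 'B(H)) := (adj A * A = A * adj A)%g.

Definition unitary_op H (A : 'B(H)) := (adj A * A = 1 /\ A * adj A = 1)%g.

Lemma isometric_adjK H K (V : 'B(H, K)) x : isometric V -> adj V (V x) = x.
Proof.
move=> iV.
have VD u v : '[V u, V v] + '[V u, V v]^* = '[u, v] + '[u, v]^*.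
  have := iV (u + v) => /(congr1 (fun z => z ^+ 2)).
  by rewrite linearD !hnormDE !iV => /addrI.
have ViD u v : '[V u, V v] = '[u, v].
  have e1 := VD u v; have := VD ('i *: u) v.
  rewrite linearZ !hdotZl !rmorphM /= conjCi !mulNr -!mulrBr.
  move=> /(mulfI (neq0Ci _)) e2.
  have := congr2 (fun a b => a + b) e1 e2.
  rewrite addrACA subrr addr0 [RHS]addrACA subrr addr0 -!mulr2n.
  by apply: (@pmulrnI _ 2).
by apply: hdot_extr => z; rewrite -adjP ViD.
Qed.

(* For an isometric V, the operator V V^* is the orthogonal projection onto the
   range of V. *)
Lemma isometric_orthoproj H K (V : 'B(H, K)) y x : isometric V ->
  '[y - V (adj V y), V x] = 0.
Proof.
by move=> iV; rewrite hdotBl adjP isometric_adjK// (hdotC y) adjP -hdotC subrr.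
Qed.

(* A Hilbert space K containing H is represented by an isometric V : 'B(H, K).
   Since V V^* is the orthogonal projection P_H onto the copy of H in K, the
   operator P_H A |_H, seen as an operator on H, is V^* A V. *)
Definition compression H K (V : 'B(H, K)) (A : 'B(K)) : 'B(H) :=
  bop_comp (adj V) (bop_comp A V).

End OperatorClasses.

Local Open Scope group_scope.

Section Order.
Variables (G : groupType) (P : set G).
Implicit Types g h u x y : G.

Definition ple x y := P (x^-1 * y).

Definition is_join g h u :=
  [/\ ple g u, ple h u & forall v, ple g v -> ple h v -> ple u v].

Definition is_meet g h u :=
  [/\ ple u g, ple u h & forall v, ple v g -> ple v h -> ple v u].

Record lattice_ordered_semigroup : Prop := {
  los1 : P 1 ;
  losM : forall p q, P p -> P q -> P (p * q) ;
  los_pointed : forall p, P p -> P p^-1 -> p = 1 ;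
  los_generates : forall g, exists p q, [/\ P p, P q & g = p^-1 * q] ;
  los_normal : forall g p, P p -> P (g * p * g^-1) ;
  los_join : forall g h, exists u, is_join g h u ;
  los_meet : forall g h, exists u, is_meet g h u
}.

Definition abelian_semigroup := forall p q, P p -> P q -> p * q = q * p.

Definition is_decomposition g gm gp :=
  [/\ P gm, P gp, is_meet gp gm 1 & g = gm^-1 * gp].

Hypothesis losP : lattice_ordered_semigroup.

Lemma ple_anti x y : ple x y -> ple y x -> x = y.
Proof.
move=> xy yx; suff : x^-1 * y = 1 by move/mulg1_eq; rewrite invgK.
by apply: (los_pointed losP) => //; rewrite invgM invgK.
Qed.

Lemma ple_mulr x y z : ple x y -> ple (x * z) (y * z).
Proof.
move=> /(los_normal losP z^-1); rewrite /ple invgK invgM.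
by rewrite !mulgA.
Qed.

Lemma ple_mull x y z : ple x y -> ple (z * x) (z * y).
Proof. by rewrite /ple invgM mulgA mulgVK. Qed.

Lemma decomposition_exists g : exists gm gp, is_decomposition g gm gp.
Proof.
have [u [gu u1 umin]] := los_join losP g 1.
have Pu : P u by move: u1; rewrite /ple invg1 mul1g.
have Pug : P (u * g^-1).
  by have := ple_mulr g^-1 gu; rewrite /ple mulgV invg1 mul1g.
exists (u * g^-1), u; split=> //; last by rewrite invgM invgK mulgVK.
split; rewrite /ple ?invg1 ?mul1g// => v vu vug.
have h : ple u (v^-1 * u).
  apply: umin.
    have := ple_mull v^-1 (ple_mulr g vug).
    by rewrite mulgVK mulgA mulVg mul1g.
  by have := ple_mull v^-1 vu; rewrite mulVg.
by have := ple_mulr u^-1 h; rewrite /ple mulgV mulgK invg1 mul1g mulg1.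
Qed.

Lemma decomposition_unique g gm gp hm hp :
  is_decomposition g gm gp -> is_decomposition g hm hp -> gm = hm /\ gp = hp.
Proof.
have half k m n p : is_decomposition k m p -> forall q,
    is_decomposition k n q -> ple p q.
  move=> [Pm Pp [_ _ mt] kE] q [Pn Pq _ kE'].
  have h : ple (p * q^-1) 1.
    apply: mt; rewrite /ple invgM invgK; first by rewrite mulgVK.
    suff -> : q * p^-1 * m = n by [].
    have -> : m = p * k^-1 by rewrite kE invgM invgK mulVKg.
    by rewrite mulgA mulgVK kE' invgM invgK mulVKg.
  by have := ple_mulr q h; rewrite mulgVK mul1g.
move=> d1 d2; have e : gp = hp.
  by apply: ple_anti; [exact: half d1 _ d2 | exact: half d2 _ d1].
split=> //; case: d1 d2 => [_ _ _ ->] [_ _ _]; rewrite e => /mulIg.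
exact: invg_inj.
Qed.

End Order.

(* Positions are numbered from 0. *)
Definition finseq (G : groupType) : Type := {fsfun nat -> G with 1}.

HB.instance Definition _ (G : groupType) := Choice.on (finseq G).

Section FinSeq.
Variable G : groupType.
Implicit Types f g h : finseq G.

Definition finseq1 : finseq G := [fsfun with 1].
Definition finseqM f g : finseq G :=
  [fsfun n in (finsupp f `|` finsupp g)%fset => f n * g n].
Definition finseqV f : finseq G := [fsfun n in finsupp f => (f n)^-1].

Lemma finseq1E n : finseq1 n = 1.
Proof. by rewrite fsfunE. Qed.

Lemma finseqME f g n : finseqM f g n = f n * g n.
Proof.
rewrite fsfunE in_fsetU; case: finsuppP => [_|//].
by case: finsuppP => // _; rewrite mulg1.
Qed.

Lemma finseqVE f n : finseqV f n = (f n)^-1.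
Proof. by rewrite fsfunE; case: finsuppP => // _; rewrite invg1. Qed.

Lemma finseqA : associative finseqM.
Proof. by move=> f g h; apply/fsfunP => n; rewrite !finseqME mulgA. Qed.
Lemma finseq1M : left_id finseq1 finseqM.
Proof. by move=> f; apply/fsfunP => n; rewrite finseqME finseq1E mul1g. Qed.
Lemma finseqM1 : right_id finseq1 finseqM.
Proof. by move=> f; apply/fsfunP => n; rewrite finseqME finseq1E mulg1. Qed.
Lemma finseqVM : left_inverse finseq1 finseqV finseqM.
Proof.
by move=> f; apply/fsfunP => n; rewrite finseqME finseqVE finseq1E mulVg.
Qed.
Lemma finseqMV : right_inverse finseq1 finseqV finseqM.
Proof.
by move=> f; apply/fsfunP => n; rewrite finseqME finseqVE finseq1E mulgV.
Qed.

HB.instance Definition _ :=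
  isGroup.Build (finseq G) finseqA finseq1M finseqM1 finseqVM finseqMV.

End FinSeq.

Definition Pinf (G : groupType) (P : set G) : set (finseq G) :=
  [set f | forall n, P (f n)].

Definition delta (G : groupType) (g : G) (n : nat) : finseq G :=
  [fsfun k in [fset n]%fset => g].

Lemma deltaE (G : groupType) (g : G) n k :
  delta g n k = if k == n then g else 1.
Proof. by rewrite fsfunE in_fset1. Qed.

Section PinfLattice.
Variables (G : groupType) (P : set G).
Hypothesis losP : lattice_ordered_semigroup P.
Implicit Types f g u : finseq G.

Lemma finseq_choice (S : {fset nat}) (Q : nat -> G -> Prop) :
  (forall n, exists x, Q n x) -> (forall n, n \notin S -> Q n 1) ->
  exists f, forall n, Q n (f n).
Proof.
move=> /choice[F QF] Q1; exists ([fsfun n in S => F n] : finseq G) => n.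
by rewrite fsfunE; case: ifPn => [_|/Q1].
Qed.

Lemma Pinf_join f g u :
  (forall n, is_join P (f n) (g n) (u n)) -> is_join (Pinf P) f g u.
Proof.
move=> ju; split=> [n|n|v fv gv n]; rewrite finseqME finseqVE.
- by case: (ju n).
- by case: (ju n).
- by case: (ju n) => _ _; apply; [have := fv n|have := gv n];
    rewrite finseqME finseqVE.
Qed.

Lemma Pinf_meet f g u :
  (forall n, is_meet P (f n) (g n) (u n)) -> is_meet (Pinf P) f g u.
Proof.
move=> ju; split=> [n|n|v fv gv n]; rewrite finseqME finseqVE.
- by case: (ju n).
- by case: (ju n).
- by case: (ju n) => _ _; apply; [have := fv n|have := gv n];
    rewrite finseqME finseqVE.
Qed.

Lemma Pinf_lattice_ordered : lattice_ordered_semigroup (Pinf P).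
Proof.
have P1 := los1 losP.
have out f g n : n \notin (finsupp f `|` finsupp g)%fset -> f n = 1 /\ g n = 1.
  by rewrite in_fsetU negb_or => /andP[/fsfun_dflt-> /fsfun_dflt->].
split.
- by move=> n; rewrite finseq1E.
- by move=> p q Pp Pq n; rewrite finseqME; exact: losM.
- move=> p Pp PVp; apply/fsfunP => n; rewrite finseq1E.
  by apply: (los_pointed losP) => //; have := PVp n; rewrite finseqVE.
- move=> g.
  have [|n /fsfun_dflt gn|p pP] :=
    @finseq_choice (finsupp g) (fun n p => P p /\ P (p * g n)).
  + move=> n; have [p [q [Pp Pq gE]]] := los_generates losP (g n).
    by exists p; rewrite gE mulVKg.
  + by rewrite gn mulg1.
  + exists p, (p * g); split; [by move=> n; case: (pP n)| |by rewrite mulKg].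
    by move=> n; rewrite finseqME; case: (pP n).
- move=> g p Pp n; rewrite !finseqME finseqVE; exact: los_normal.
- move=> f g.
  have [n|n /out[-> ->]|u uP] := @finseq_choice (finsupp f `|` finsupp g)%fset
    (fun n x => is_join P (f n) (g n) x); first exact: los_join.
  + by split; rewrite /ple ?mulVg// => v; rewrite mulVg.
  + by exists u; exact: Pinf_join.
- move=> f g.
  have [n|n /out[-> ->]|u uP] := @finseq_choice (finsupp f `|` finsupp g)%fset
    (fun n x => is_meet P (f n) (g n) x); first exact: los_meet.
  + by split; rewrite /ple ?mulVg// => v; rewrite mulVg.
  + by exists u; exact: Pinf_meet.
Qed.

Lemma Pinf_abelian : abelian_semigroup P -> abelian_semigroup (Pinf P).
Proof.
by move=> Pab p q Pp Pq; apply/fsfunP => n; rewrite !finseqME; exact: Pab.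
Qed.

End PinfLattice.

(* A map defined on P is given by a function on all of G whose values outside P
   are never constrained nor used. *)
Definition representation (R : realType) (G : groupType) (P : set G)
    (H : hilbertType R) (T : G -> 'B(H)) : Prop :=
  T 1 = 1 /\ forall p q, P p -> P q -> T (p * q) = T p * T q.

Definition contractive (R : realType) (G : groupType) (P : set G)
    (H : hilbertType R) (T : G -> 'B(H)) : Prop :=
  forall p, P p -> (opnorm (T p) <= 1)%R.

Definition normal_rep (R : realType) (G : groupType) (P : set G)
    (H : hilbertType R) (T : G -> 'B(H)) : Prop :=
  forall p, P p -> normal_op (T p).

Definition unitary_representation (R : realType) (G : groupType)
    (K : hilbertType R) (U : G -> 'B(K)) : Prop :=
  representation setT U /\ forall g, unitary_op (U g).

Definition regular_representation (R : realType) (G : groupType) (P : set G)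
    (H : hilbertType R) (T : G -> 'B(H)) : Prop :=
  exists (K : hilbertType R) (V : 'B(H, K)) (U : G -> 'B(K)),
    [/\ isometric V, unitary_representation U &
        forall g gm gp, is_decomposition P g gm gp ->
          adj (T gm) * T gp = compression V (U g)].

(* The factors T (f n) commute when P is abelian, so the order of the product is
   irrelevant. *)
Definition Tinf (R : realType) (G : groupType) (H : hilbertType R)
    (T : G -> 'B(H)) (f : finseq G) : 'B(H) :=
  \prod_(n <- finsupp f) T (f n).

Section TinfTheory.
Variables (R : realType) (G : groupType) (P : set G) (H : hilbertType R).
Variable T : G -> 'B(H).
Hypotheses (P1 : P 1) (PM : forall p q, P p -> P q -> P (p * q)).
Hypotheses (Pab : abelian_semigroup P) (repT : representation P T).
Implicit Types f g : finseq G.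

Let Tcomm p q : P p -> P q -> T p * T q = T q * T p.
Proof. by move=> Pp Pq; rewrite -!repT.2// Pab. Qed.

Let prod_comm (s : seq nat) (f : nat -> G) p :
  P p -> (forall n, P (f n)) ->
  T p * (\prod_(n <- s) T (f n)) = (\prod_(n <- s) T (f n)) * T p.
Proof.
move=> Pp Pf; elim: s => [|n s IH]; first by rewrite !big_nil mulg1 mul1g.
by rewrite !big_cons mulgA (Tcomm Pp (Pf n)) -!mulgA IH.
Qed.

Let prods_comm (s t : seq nat) (f : nat -> G) :
  (forall n, P (f n)) ->
  (\prod_(n <- s) T (f n)) * (\prod_(n <- t) T (f n)) =
  (\prod_(n <- t) T (f n)) * (\prod_(n <- s) T (f n)).
Proof.
move=> Pf; elim: s => [|n s IH]; first by rewrite !big_nil mulg1 mul1g.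
by rewrite !big_cons -mulgA IH mulgA prod_comm// mulgA.
Qed.

Let prodM (s : seq nat) (f g : nat -> G) :
  (forall n, P (f n)) -> (forall n, P (g n)) ->
  \prod_(n <- s) T (f n * g n) =
  (\prod_(n <- s) T (f n)) * (\prod_(n <- s) T (g n)).
Proof.
move=> Pf Pg; elim: s => [|n s IH]; first by rewrite !big_nil mulg1.
rewrite !big_cons IH repT.2// -!mulgA; congr (_ * _).
by rewrite !mulgA prod_comm.
Qed.

Let prod_perm (s t : seq nat) (f : nat -> G) : (forall n, P (f n)) ->
  perm_eq s t -> \prod_(n <- s) T (f n) = \prod_(n <- t) T (f n).
Proof.
move=> Pf; apply: (@catCA_perm_subst _ _ (fun s => \prod_(n <- s) T (f n))).
by move=> s1 s2 s3; rewrite !big_cat/= !mulgA prods_comm.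
Qed.

Lemma Tinf_widen (s : seq nat) f : Pinf P f -> uniq s ->
  {subset finsupp f <= s} -> Tinf T f = \prod_(n <- s) T (f n).
Proof.
move=> Pf us fs; rewrite /Tinf -[RHS](big_rmcond [in finsupp f]).
  rewrite -[RHS]big_filter; apply: prod_perm => //.
  apply: uniq_perm; rewrite ?filter_uniq ?fset_uniq// => n.
  by rewrite mem_filter; apply/idP/andP => [nf|[]//]; split=> //; exact: fs.
by move=> n /fsfun_dflt ->; exact: repT.1.
Qed.

Lemma Tinf_representation : representation (Pinf P) (Tinf T).
Proof.
split=> [|f g Pf Pg].
  rewrite /Tinf; apply: big1 => n _; rewrite finseq1E; exact: repT.1.
have Pfg : Pinf P (f * g) by move=> n; rewrite finseqME; exact: PM.
pose s := enum_fset (finsupp f `|` finsupp g)%fset.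
have us : uniq s by exact: fset_uniq.
have fs : {subset finsupp f <= s} by move=> n nf; rewrite /s in_fsetU nf.
have gs : {subset finsupp g <= s} by move=> n ng; rewrite /s in_fsetU ng orbT.
have fgs : {subset finsupp (f * g) <= s}.
  move=> n; rewrite mem_finsupp finseqME /s in_fsetU !mem_finsupp -negb_and.
  by apply: contra => /andP[/eqP-> /eqP->]; rewrite mulg1.
rewrite (Tinf_widen Pfg us fgs) (Tinf_widen Pf us fs) (Tinf_widen Pg us gs).
rewrite -prodM//; apply: eq_bigr => n _.
by rewrite finseqME.
Qed.

Lemma delta_Pinf p n : P p -> Pinf P (delta p n).
Proof. by move=> Pp k; rewrite deltaE; case: ifP. Qed.

Lemma Tinf_delta p n : P p -> Tinf T (delta p n) = T p.
Proof.
move=> Pp; rewrite (@Tinf_widen [:: n])//; last 2 first.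
- exact: delta_Pinf.
- move=> k; rewrite mem_finsupp deltaE inE; by case: (k == n); rewrite ?eqxx.
by rewrite big_seq1 deltaE eqxx.
Qed.

Lemma Tinf_unique (S : finseq G -> 'B(H)) : representation (Pinf P) S ->
  (forall p n, P p -> S (delta p n) = T p) ->
  forall f, Pinf P f -> S f = Tinf T f.
Proof.
move=> [S1 SM] Sd f Pf.
have dE (s : seq nat) : uniq s -> forall k,
    (\prod_(n <- s) delta (f n) n : finseq G) k = if k \in s then f k else 1.
  elim: s => [|n s IH] /=; first by move=> _ k; rewrite big_nil finseq1E.
  move=> /andP[ns us] k; rewrite big_cons finseqME IH// deltaE inE.
  have [->|_] := eqVneq k n; last by rewrite mul1g.
  by rewrite (negbTE ns) mulg1.
have Pd (s : seq nat) : Pinf P (\prod_(n <- s) delta (f n) n).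
  elim/big_ind: _ => [n|g h Pg Ph n|n _]; rewrite ?finseq1E ?finseqME//.
  - exact: PM.
  - exact: delta_Pinf.
have -> : S f = S (\prod_(n <- finsupp f) delta (f n) n).
  congr S; apply/fsfunP => k; rewrite dE ?fset_uniq//.
  by case: finsuppP.
rewrite /Tinf; elim: (enum_fset _) => [|n s IH]; first by rewrite !big_nil.
by rewrite !big_cons SM ?Sd ?IH//; exact: delta_Pinf.
Qed.

End TinfTheory.

(* Main.v *)
(* (i) => (ii). By Fuglede's theorem the operators [N p] commute with the adjoints
   [(N q)^*], so it suffices to dilate a star-commuting contractive representation
   [N] of a lattice ordered semigroup. The dilation lives on the Hilbert space of the
   kernel [k((p,h),(q,g)) = <N(m^-1 p) h, N(m^-1 q) g>], [m] the meet of [p] and [q],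
   on which the group acts by translation. Positivity of [k] comes from the commuting
   projections onto the spans of the vectors below a given group element: it reduces
   to Brehmer's inequalities, which follow by induction from the contractivity of [N].

   (ii) => (i). Restrict the unitary dilation [U] of [Tinf T] to the span of the vectors
   [U g V h]. Then [U (delta r n)] converges weakly, as [n] tends to infinity, to a
   contraction [N r] with [N r (U g V h) = U g V (T r h)]. It extends [T r], is
   multiplicative in [r], and is normal because it commutes with the whole group. *)

From HB Require Import structures.
Require Import Defs.
From mathcomp Require Import all_boot all_order all_algebra finmap.
From mathcomp Require Import all_classical reals topology normedtype.
From mathcomp Require Import complex ring.
From mathcomp Require Import separable cyclic cyclotomic.

Set Implicit Arguments.
Unset Strict Implicit.
Unset Printing Implicit Defensive.

Import Order.TTheory GRing.Theory Num.Theory.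
Import numFieldNormedType.Exports.

Local Open Scope classical_set_scope.
Local Open Scope ring_scope.

(** * Completeness of the complex numbers *)

Lemma gt0_complexE (R : realType) (e : R[i]) : 0 < e ->
  exists2 r : R, 0 < r & e = r%:C%C.
Proof.
move=> e0; exists (complex.Re e); first by move: e0; rewrite ltcE => /andP[].
by rewrite RRe_real// gtr0_real.
Qed.

Lemma normc_Re_lt (R : realType) (z : R[i]) (e : R) :
  `|z| < e%:C%C -> `|complex.Re z| < e.
Proof. by move=> ze; rewrite -ltcR; apply: le_lt_trans ze; exact: normc_ge_Re. Qed.

Lemma normc_Im_lt (R : realType) (z : R[i]) (e : R) :
  `|z| < e%:C%C -> `|complex.Im z| < e.
Proof.
move=> ze; rewrite -normrN -ReiNIm; apply: normc_Re_lt.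
by rewrite normrM complexiE normCi mulr1.
Qed.

Lemma normc_le_ReIm (R : realType) (z : R[i]) :
  `|z| <= (`|complex.Re z| + `|complex.Im z|)%:C%C.
Proof.
rewrite [z in leLHS]complexE; apply: le_trans (ler_normD _ _) _.
rewrite normrM complexiE normCi mul1r rmorphD.
by rewrite !normc_def /= !expr0n !addr0 !sqrtr_sqr.
Qed.

(** Real and imaginary part are 1-Lipschitz, so both images of the filter are Cauchy in [R]; the two
    real limits assemble to a complex one. *)
Lemma complex_cauchy_cvg (R : realType) (F : set_system R[i]^o) :
  ProperFilter F -> cauchy F -> cvg F.
Proof.
move=> FF /cauchyP Fc.
have coord (p : R[i]^o -> R) :
    (forall (z w : R[i]) e, `|z - w| < e%:C%C -> `|p z - p w| < e) -> cvg (p @ F).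
  move=> pl; apply: cauchy_cvg; apply: cauchy_exP => e e0.
  have e0c : 0 < e%:C%C :> R[i] by rewrite -(rmorph0 (real_complex R)) ltcR.
  have [z Fz] := Fc _ e0c; exists (p z).
  by apply: (@filterS _ F _ _ _ _ Fz) => w; rewrite -!ball_normE; exact: pl.
have /cvg_ex[a Fa] : cvg (@complex.Re R @ F).
  by apply: coord => z w e h; rewrite -raddfB; exact: normc_Re_lt.
have /cvg_ex[b Fb] : cvg (@complex.Im R @ F).
  by apply: coord => z w e h; rewrite -raddfB; exact: normc_Im_lt.
apply/cvg_ex; exists (a +i* b)%C; apply/cvgrPdist_lt => e /gt0_complexE[r r0 ->].
have r20 : 0 < r / 2 by rewrite divr_gt0.
move/cvgrPdist_lt : Fa => /(_ _ r20) Fa; move/cvgrPdist_lt : Fb => /(_ _ r20) Fb.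
near=> z; apply: le_lt_trans (normc_le_ReIm _) _.
rewrite ltcR [r]splitr ltrD// raddfB /=; near: z; [exact: Fa|exact: Fb].
Unshelve. all: by end_near. Qed.

(** * Positive definite kernels *)

Section ComplexInequalities.
Variable C : numClosedFieldType.
Implicit Types a b c x y : C.

(** Only [l = - x c] with [x >= 0] is tested; [x = b^-1] gives the bound when [b != 0]. This is the
    source of both the Cauchy-Schwarz inequality and the near-minimiser estimate below. *)
Lemma discriminant_le a b c : 0 <= b ->
  (forall l, 0 <= a + (l^* * c + l * c^*) + `|l| ^+ 2 * b) ->
  `|c| ^+ 2 <= a * b.
Proof.
move=> b0 h; have a0 : 0 <= a by have := h 0; rewrite conjC0 normr0 expr0n !mul0r !addr0.
have hx x : 0 <= x -> 0 <= a - 2 * x * `|c| ^+ 2 + x ^+ 2 * `|c| ^+ 2 * b.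
  move=> x0; have := h (- (x * c)); rewrite normrN normrM exprMn (ger0_norm x0).
  rewrite rmorphN rmorphM /= (CrealP (ger0_real x0)); congr (0 <= _ + _ + _).
  by rewrite normCK; ring.
have [->|c0] := eqVneq c 0; first by rewrite normr0 expr0n mulr_ge0.
have n0 : 0 < `|c| ^+ 2 by rewrite exprn_gt0 ?normr_gt0.
have [b00|b00] := eqVneq b 0.
  (* With [b = 0] the form is affine in [x], and this [x] gives it the negative value [- a - 2]. *)
  have := hx ((a + 1) / `|c| ^+ 2) (divr_ge0 (addr_ge0 a0 ler01) (ltW n0)).
  rewrite b00 !mulr0 addr0 -mulrA divfK ?gt_eqF// => ha.
  have : 0 <= - a - 2 by move: ha; congr (0 <= _); ring.
  rewrite -opprD oppr_ge0 => a2; have := le_lt_trans a2 (_ : 0 < a + 2).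
  by rewrite ltxx ltr_wpDl// => /(_ isT).
have bgt : 0 < b by rewrite lt_def b00.
have := hx b^-1; rewrite invr_ge0 => /(_ b0).
have -> : a - 2 * b^-1 * `|c| ^+ 2 + b^-1 ^+ 2 * `|c| ^+ 2 * b =
  (a * b - `|c| ^+ 2) / b by field.
by rewrite pmulr_lge0 ?invr_gt0// subr_ge0.
Qed.

(** Restricting to [d <= 1] allows later error terms such as [d ^+ 2] or [(M + d) * d] to be bounded
    linearly in [d]. *)
Lemma eq_of_small x y c : (forall d, 0 < d -> d <= 1 -> `|x - y| <= c * d) -> x = y.
Proof.
move=> h; apply/eqP; rewrite -subr_eq0 -normr_le0.
have c0 : 0 <= c by have := h 1 ltr01 (lexx _); rewrite mulr1; exact: le_trans.
apply/ler_addgt0Pr => e e0; rewrite add0r.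
have c1 : 0 < c + 1 by rewrite ltr_wpDl.
have [le1|lt1] := real_leP (gtr0_real (divr_gt0 e0 c1)) (real1 C).
  apply: le_trans (h _ (divr_gt0 e0 c1) le1) _.
  by rewrite mulrCA ger_pMr// ler_pdivrMr// mul1r lerDl.
apply: le_trans (h 1 ltr01 (lexx _)) _; rewrite mulr1.
by move: lt1; rewrite ltr_pdivlMr// mul1r => /ltW; apply: le_trans; rewrite lerDl.
Qed.

Lemma le_of_small x y c : x \is Num.real -> y \is Num.real ->
  (forall d, 0 < d -> d <= 1 -> x <= y + c * d) -> x <= y.
Proof.
move=> xr yr h; have [//|yx] := real_leP xr yr.
have xy0 : 0 < x - y by rewrite subr_gt0.
have c0 : 0 <= c.
  have := h 1 ltr01 (lexx _); rewrite mulr1 -lerBlDl; apply: le_trans; exact: ltW.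
suff xy : x = y by rewrite xy ltxx in yx.
apply: (@eq_of_small _ _ c) => d d0 d1.
by rewrite gtr0_norm// lerBlDl h.
Qed.

End ComplexInequalities.

Section FormalCombinations.
Variables (R : realType) (X : Type).
Local Notation C := R[i].
Implicit Types (s t : seq (C * X)) (f g : X -> C).

Definition scale_comb (a : C) s := [seq (a * p.1, p.2) | p <- s].

(* The coefficients are conjugated because [f] stands for the conjugate-linear
   functional [fun h => '[f, h]] restricted to the formal combinations. *)
Definition eval f s := \sum_(p <- s) p.1^* * f p.2.

Definition kcomb (k : X -> X -> C) s x := \sum_(p <- s) p.1 * k p.2 x.

Definition kform k s t := eval (kcomb k s) t.

Lemma eval_cat f s t : eval f (s ++ t) = eval f s + eval f t.
Proof. by rewrite /eval big_cat. Qed.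

Lemma eval_scale f a s : eval f (scale_comb a s) = a^* * eval f s.
Proof.
by rewrite /eval big_map mulr_sumr; apply: eq_bigr => p _; rewrite rmorphM mulrA.
Qed.

Lemma evalD f g s : eval (f \+ g) s = eval f s + eval g s.
Proof. by rewrite /eval -big_split; apply: eq_bigr => p _; rewrite mulrDr. Qed.

Lemma evalZ a f s : eval (fun x => a * f x) s = a * eval f s.
Proof. by rewrite /eval mulr_sumr; apply: eq_bigr => p _; rewrite mulrCA. Qed.

Lemma eval1 f x : eval f [:: (1, x)] = f x.
Proof. by rewrite /eval big_seq1 conjC1 mul1r. Qed.

Definition map_comb (tau : X -> X) s := [seq (p.1, tau p.2) | p <- s].

Lemma eval_map f tau s : eval f (map_comb tau s) = eval (f \o tau) s.
Proof. by rewrite /eval big_map. Qed.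

Lemma kform_cat k s s' t : kform k (s ++ s') t = kform k s t + kform k s' t.
Proof. by rewrite /kform -evalD; congr eval; apply/funext=> x; rewrite /kcomb big_cat. Qed.

Lemma kform_scale k a s t : kform k (scale_comb a s) t = a * kform k s t.
Proof.
rewrite /kform -evalZ; congr eval; apply/funext=> x; rewrite /kcomb big_map mulr_sumr.
by apply: eq_bigr => p _; rewrite mulrA.
Qed.

Lemma kformE k s t :
  kform k s t = \sum_(p <- s) \sum_(q <- t) p.1 * q.1^* * k p.2 q.2.
Proof.
rewrite exchange_big; apply: eq_bigr => q _; rewrite mulr_sumr; apply: eq_bigr => p _.
by rewrite mulrCA mulrA.
Qed.

Lemma kform_map k tau s t :
  kform k (map_comb tau s) (map_comb tau t) = kform (fun x y => k (tau x) (tau y)) s t.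
Proof.
by rewrite !kformE big_map; apply: eq_bigr => p _; rewrite big_map.
Qed.

Record pskernel := PSKernel {
  kfun :> X -> X -> C ;
  kfunC : forall x y, kfun x y = (kfun y x)^* ;
  kform_ge0 : forall s, 0 <= kform kfun s s
}.

End FormalCombinations.

Section PositiveKernel.
Variables (R : realType) (X : Type) (k : pskernel R X).
Local Notation C := R[i].
Implicit Types (s t : seq (C * X)) (f g : X -> C).

Definition kseminorm s : C := sqrtC (kform k s s).

Lemma kseminorm_ge0 s : 0 <= kseminorm s.
Proof. by rewrite sqrtC_ge0 kform_ge0. Qed.

Lemma sqr_kseminorm s : kseminorm s ^+ 2 = kform k s s.
Proof. exact: sqrtCK. Qed.

Lemma kformC s t : kform k s t = (kform k t s)^*.
Proof.
rewrite !kformE rmorph_sum exchange_big; apply: eq_bigr => q _ /=.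
rewrite rmorph_sum; apply: eq_bigr => p _ /=.
by rewrite !rmorphM /= -kfunC conjCK [q.1^* * _]mulrC.
Qed.

(** Cauchy-Schwarz for a possibly degenerate form: the discriminant of [l |-> |s + l t|^2]. *)
Lemma kform_bound s t : `|kform k s t| <= kseminorm s * kseminorm t.
Proof.
rewrite -ler_sqr ?nnegrE ?mulr_ge0 ?kseminorm_ge0// exprMn !sqr_kseminorm.
apply: discriminant_le => [|l]; first exact: kform_ge0.
have := kform_ge0 k (s ++ scale_comb l t).
rewrite kform_cat kform_scale {1 2}/kform !eval_cat !eval_scale -!/(kform k _ _).
by rewrite (kformC t s) normCK; congr (0 <= _); ring.
Qed.

Definition dual_bound f (M : C) := 0 <= M /\ forall t, `|eval f t| <= M * kseminorm t.

Lemma dual_bound_kcomb s : dual_bound (kcomb k s) (kseminorm s).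
Proof. by split; [exact: kseminorm_ge0|exact: kform_bound]. Qed.

Definition approx f (d : C) s := forall t, `|eval f t - kform k s t| <= d * kseminorm t.

Lemma approxE f d s : 0 <= d ->
  approx f d s <-> dual_bound (fun x => f x - kcomb k s x) d.
Proof.
move=> d0; have e t : eval (fun x => f x - kcomb k s x) t = eval f t - kform k s t.
  rewrite -[- kform _ _ _]mulN1r /kform -evalZ -evalD; congr eval.
  by apply/funext => x /=; rewrite mulN1r.
by split=> [h|[_ h] t]; [split=> // t; rewrite e|rewrite -e].
Qed.

(* As in the Riesz theorem, a near-minimiser [s] of [|s|^2 - 2 Re f(s)] represents
   [f] up to a small error in dual norm. *)
Lemma approx_exists f M d : dual_bound f M -> 0 < d -> exists s, approx f d s.
Proof.
move=> [M0 fM] d0.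
pose q s : C := kform k s s - (eval f s + (eval f s)^*).
have q_real s : q s \is Num.real.
  apply: realB; first by rewrite ger0_real ?kform_ge0.
  by apply/CrealP; rewrite rmorphD /= conjCK addrC.
have qE s : (complex.Re (q s))%:C%C = q s by exact: RRe_real.
have q_lb s : - M ^+ 2 <= q s.
  have h : eval f s + (eval f s)^* <= 2 * (M * kseminorm s).
    have := (leif_Re_Creal (eval f s)).1; rewrite ReE ler_pdivrMr// mulrC => /le_trans.
    by apply; rewrite ler_pM2l.
  rewrite /q -sqr_kseminorm -subr_ge0; set u := kseminorm s in h *.
  have r0 : 0 <= (u - M) ^+ 2.
    by rewrite real_exprn_even_ge0// realB ?ger0_real ?kseminorm_ge0.
  apply: le_trans r0 _; rewrite -subr_ge0.
  by move: h; rewrite -subr_ge0; congr (0 <= _); ring.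
pose S : set R := range (fun s => complex.Re (q s)).
have Sinf : has_inf S.
  split; first by exists (complex.Re (q [::])), [::].
  exists (complex.Re (- M ^+ 2)) => _ [s _ <-].
  by have := q_lb s; rewrite lecE => /andP[].
(* The gap to the infimum is taken to be [d ^+ 2], because the discriminant bounds the squared error
   at [t] by this gap times [kform k t t]. *)
have [e e0 eE] := gt0_complexE (exprn_gt0 2 d0).
have [_ [s _ <-] sS] := inf_adherent e0 Sinf.
exists s => t; rewrite -ler_sqr ?nnegrE ?mulr_ge0 ?kseminorm_ge0 ?(ltW d0)//.
rewrite exprMn sqr_kseminorm -normrN; apply: discriminant_le => [|l].
  exact: kform_ge0.
have hs : q s <= q (s ++ scale_comb l t) + d ^+ 2.
  rewrite -(qE s) -(qE (s ++ scale_comb l t)) eE -rmorphD lecR; apply: le_trans (ltW sS) _.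
  by rewrite lerD2r; apply: ge_inf; [exact: Sinf.2|exists (s ++ scale_comb l t)].
move: hs; rewrite /q kform_cat kform_scale {2 3}/kform !eval_cat !eval_scale.
rewrite -!/(kform k _ _) (kformC t s) normCK -subr_ge0; congr (0 <= _).
by rewrite !(rmorphB, rmorphD, rmorphM, rmorphN) /= conjCK; ring.
Qed.

End PositiveKernel.

(** * The Hilbert space of a kernel *)

Section DualBounded.
Variables (R : realType) (X : Type) (k : pskernel R X).
Local Notation C := R[i].
Implicit Types (s t : seq (C * X)) (f g : X -> C).

Lemma dual_bound_lin a f g M M' : dual_bound k f M -> dual_bound k g M' ->
  dual_bound k (fun x => a * f x + g x) (`|a| * M + M').
Proof.
move=> [M0 fM] [M'0 gM]; split=> [|t]; first by rewrite addr_ge0// mulr_ge0.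
rewrite (evalD (fun x => a * f x)) evalZ mulrDl.
by rewrite (le_trans (ler_normD _ _))// normrM -mulrA lerD// ler_wpM2l.
Qed.

Lemma dual_bound0 : dual_bound k (fun=> 0) 0.
Proof.
by split=> // t; rewrite mul0r /eval big1 ?normr0// => p _; rewrite mulr0.
Qed.

Definition dual_bounded : {pred X -> C} := [pred f | `[< exists M, dual_bound k f M >]].

Lemma dual_bounded_submod_closed : submod_closed dual_bounded.
Proof.
split=> [|a f g]; first by apply/asboolP; exists 0; exact: dual_bound0.
move=> /asboolP[M fM] /asboolP[M' gM]; apply/asboolP; exists (`|a| * M + M').
exact: dual_bound_lin.
Qed.

HB.instance Definition _ :=
  GRing.isSubmodClosed.Build C (X -> C) dual_bounded dual_bounded_submod_closed.

(* The Hilbert space of a kernel is taken to be the dual of the seminormed space of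
   formal combinations: it is complete for free, and neither a quotient nor a
   completion is needed. *)
Record rkhs := RKHS { rkhs_fun :> X -> C ; _ : rkhs_fun \in dual_bounded }.

HB.instance Definition _ := [isSub for rkhs_fun].
HB.instance Definition _ := [Choice of rkhs by <:].
HB.instance Definition _ := [SubChoice_isSubLmodule of rkhs by <:].

End DualBounded.

Lemma le_of_sqr (C : numDomainType) (a b : C) : 0 <= a -> 0 <= b ->
  a ^+ 2 <= b * a -> a <= b.
Proof.
by move=> a0 b0; have [->//|an] := eqVneq a 0; rewrite expr2 ler_pM2r// lt_def an.
Qed.

Section ReproducingKernel.
Variables (R : realType) (X : Type) (k : pskernel R X).
Local Notation C := R[i].
Local Notation K := (rkhs k).
Implicit Types (s t : seq (C * X)) (f g h : K).

Lemma rkhsP f g : (forall x, f x = g x) -> f = g.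
Proof. by move=> e; apply/val_inj/funext. Qed.

Lemma rkhs_bound f : exists M, dual_bound k f M.
Proof. by case: f => f /= /asboolP. Qed.

Lemma approx_kseminorm f M d s : dual_bound k f M -> 0 <= d -> approx k f d s ->
  kseminorm k s <= M + d.
Proof.
move=> [M0 fM] d0 fs; apply: le_of_sqr; rewrite ?kseminorm_ge0 ?addr_ge0//.
rewrite sqr_kseminorm -(ger0_norm (kform_ge0 k s)) mulrDl.
rewrite -[X in `|X|](subKr (eval f s)) (le_trans (ler_normB _ _))// lerD//.
Qed.

(** Two approximants of the same functional differ by a combination [u] with
    [|u|^2 <= (d + d') |u|], since both represent [g] on [u] up to their errors. *)
Lemma approx_eval_dist f g M d d' s s' : dual_bound k f M -> 0 <= d -> 0 <= d' ->
  approx k g d s -> approx k g d' s' -> `|eval f s - eval f s'| <= M * (d + d').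
Proof.
move=> [M0 fM] d0 d'0 gs gs'; pose u := s ++ scale_comb (-1) s'.
have -> : eval f s - eval f s' = eval f u.
  by rewrite eval_cat eval_scale rmorphN rmorph1 mulN1r.
apply: le_trans (fM u) _; rewrite ler_wpM2l//.
apply: le_of_sqr; rewrite ?kseminorm_ge0 ?addr_ge0// sqr_kseminorm.
rewrite -(ger0_norm (kform_ge0 k u)) {1}/u kform_cat kform_scale mulN1r.
rewrite -(subrKA (eval g u)) (le_trans (ler_normD _ _))// mulrDl.
by rewrite lerD//; rewrite distrC; exact: gs.
Qed.

(** The inner product of [f] and [g] is the limit of [f(s)] as [s] approximates [g]. The explicit
    rate [M * d] is kept because every law of the inner product is derived from it by letting [d]
    tend to 0. *)
Lemma rkhs_dot_exists f g : exists l, forall M d s, dual_bound k f M -> 0 < d ->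
  approx k g d s -> `|eval f s - l| <= M * d.
Proof.
have [Mf fMf] := rkhs_bound f; have [Mg gM] := rkhs_bound g.
have toC (r : R) : 0 < r -> 0 < r%:C%C :> C.
  by move=> r0; rewrite -(rmorph0 (real_complex R)) ltcR.
pose F := filter_from [set r : R | 0 < r] (fun r => approx k g r%:C%C).
have FF : ProperFilter F.
  apply: filter_from_proper; last by move=> r /toC /(approx_exists gM).
  apply: filter_from_filter; first by exists 1 => /=.
  move=> i j i0 j0; exists (Order.min i j); first by rewrite /= lt_min i0.
  by move=> s h; split=> t; apply: le_trans (h t) _;
    rewrite ler_wpM2r ?kseminorm_ge0// lecR ge_min lexx ?orbT.
pose G : set_system C^o := eval f @ F.
have /cvg_ex[l Gl] : cvg G.
  apply: complex_cauchy_cvg; apply: cauchy_exP => _ /gt0_complexE[r r0 ->].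
  have [m m0 mE] : exists2 m, 0 < m & Mf + 1 = m%:C%C.
    by apply: gt0_complexE; rewrite ltr_wpDl//; exact: fMf.1.
  pose d := r / (4 * m); have d0 : 0 < d by rewrite divr_gt0// mulr_gt0.
  have [s gs] := approx_exists gM (toC _ d0).
  exists (eval f s), d => // s' gs'; rewrite /= -ball_normE /=.
  have h := approx_eval_dist fMf (ltW (toC _ d0)) (ltW (toC _ d0)) gs gs'.
  apply: le_lt_trans h _; rewrite -rmorphD -mulr2n -[d *+ 2]mulr_natr.
  have hm : Mf <= m%:C%C by rewrite -mE lerDl.
  have hd : 0 <= (d * 2)%:C%C :> C by rewrite ltW// toC// mulr_gt0.
  apply: le_lt_trans (ler_wpM2r hd hm) _; rewrite -rmorphM ltcR.
  have -> : m * (d * 2) = r / 2 by rewrite /d; field; rewrite gt_eqF.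
  by rewrite ltr_pdivrMr// ltr_pMr// ltr1n.
exists l => M d s fM d0 gs; apply/ler_addgt0Pr => e e0.
have [r r0 rE] := gt0_complexE e0.
have M0 := fM.1.
have [m m0 mE] : exists2 m, 0 < m & M + 1 = m%:C%C.
  by apply: gt0_complexE; rewrite ltr_wpDl.
have e20 : 0 < e / 2 by rewrite divr_gt0.
pose d' := r / (2 * m); have d'0 : 0 < d' by rewrite divr_gt0// mulr_gt0.
have Fd' : F (approx k g d'%:C%C) by exists d'.
move/cvgrPdist_lt : Gl => /(_ _ e20) Fl.
have [s' [gs' ls']] := filter_ex (filterI Fd' Fl).
rewrite -[eval f s](subrK (eval f s')) -addrA.
apply: le_trans (ler_normD _ _) _.
have h := approx_eval_dist fM (ltW d0) (ltW (toC _ d'0)) gs gs'.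
apply: le_trans (lerD h (_ : _ <= e / 2)) _; first by rewrite distrC; exact: ltW.
rewrite mulrDr -addrA lerD2l [leRHS]splitr lerD2r.
have hm : M <= m%:C%C by rewrite -mE lerDl.
apply: le_trans (ler_wpM2r (ltW (toC _ d'0)) hm) _.
rewrite rE -rmorphM (_ : m * d' = r / 2); last by rewrite /d'; field; rewrite gt_eqF.
by rewrite rmorphM fmorphV rmorph_nat.
Qed.

Definition rkhs_dot f g : C := projT1 (cid (rkhs_dot_exists f g)).

Lemma rkhs_dotP f g M d s : dual_bound k f M -> 0 < d -> approx k g d s ->
  `|eval f s - rkhs_dot f g| <= M * d.
Proof. by rewrite /rkhs_dot; case: cid => l /=; apply. Qed.

Lemma rkhs_dot_linear g : linear_for *%R (rkhs_dot ^~ g).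
Proof.
move=> a f f'; have [M fM] := rkhs_bound f; have [M' fM'] := rkhs_bound f'.
have [Mg gM] := rkhs_bound g.
apply: (@eq_of_small _ _ _ (2 * (`|a| * M + M'))) => d d0 d1.
have [s gs] := approx_exists gM d0.
have fM2 : dual_bound k (a *: f + f') (`|a| * M + M') by exact: dual_bound_lin.
have h1 := rkhs_dotP fM2 d0 gs.
have hf := rkhs_dotP fM d0 gs; have hf' := rkhs_dotP fM' d0 gs.
rewrite -[rkhs_dot (a *: f + f') g](subrK (eval (a *: f + f') s)) -addrA.
apply: le_trans (ler_normD _ _) _; rewrite -mulrA mulr_natl mulr2n.
rewrite lerD//; first by rewrite distrC.
rewrite [eval _ s](evalD (fun x => a * f x)) evalZ opprD addrACA -mulrBr.
apply: le_trans (ler_normD _ _) _; rewrite normrM mulrDl lerD//.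
by rewrite -mulrA ler_wpM2l.
Qed.

Lemma rkhs_dotC f g : rkhs_dot f g = (rkhs_dot g f)^*.
Proof.
have [M fM] := rkhs_bound f; have [M' gM'] := rkhs_bound g.
apply: (@eq_of_small _ _ _ (2 * (M + M' + 1))) => d d0 d1.
have [s gs] := approx_exists gM' d0; have [t ft] := approx_exists fM d0.
have hs := rkhs_dotP fM d0 gs; have ht := rkhs_dotP gM' d0 ft.
have ns := approx_kseminorm gM' (ltW d0) gs; have nt := approx_kseminorm fM (ltW d0) ft.
have fs := ft s; have gt := gs t.
(* The chain is [<f, g> ~ f(s) ~ <t, s> = <s, t>^* ~ g(t)^* ~ <g, f>^*], where [s] approximates [g]
   and [t] approximates [f]. *)
rewrite (_ : _ - _ = (rkhs_dot f g - eval f s) + (eval f s - kform k t s) +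
  ((kform k s t - eval g t)^* + (eval g t - rkhs_dot g f)^*)); last first.
  by rewrite (kformC k t s) !rmorphB /=; ring.
have -> : 2 * (M + M' + 1) * d = (M * d + d * (M' + 1)) + (d * (M + 1) + M' * d) by ring.
apply: le_trans (ler_normD _ _) _; apply: lerD; apply: le_trans (ler_normD _ _) _.
  rewrite lerD//; first by rewrite distrC.
  apply: le_trans fs _; rewrite ler_wpM2l ?(ltW d0)//; apply: le_trans ns _.
  by rewrite lerD2l.
rewrite !norm_conjC lerD//.
rewrite distrC; apply: le_trans gt _; rewrite ler_wpM2l ?(ltW d0)//.
by apply: le_trans nt _; rewrite lerD2l.
Qed.

Lemma rkhs_dot_real f : rkhs_dot f f \is Num.real.
Proof. by apply/CrealP; rewrite -rkhs_dotC. Qed.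

Lemma rkhs_dot_kform f M d s : dual_bound k f M -> 0 < d -> d <= 1 ->
  approx k f d s -> `|kform k s s - rkhs_dot f f| <= (2 * M + 1) * d.
Proof.
move=> fM d0 d1 fs; rewrite -(subrKA (eval f s)).
apply: le_trans (ler_normD _ _) _.
have -> : (2 * M + 1) * d = d * (M + 1) + M * d by ring.
rewrite lerD ?(rkhs_dotP fM d0 fs)// distrC; apply: le_trans (fs s) _.
rewrite ler_wpM2l ?(ltW d0)//; apply: le_trans (approx_kseminorm fM (ltW d0) fs) _.
by rewrite lerD2l.
Qed.

Lemma rkhs_dot_ge0 f : 0 <= rkhs_dot f f.
Proof.
have [M fM] := rkhs_bound f.
apply: (@le_of_small _ _ _ (2 * M + 1)); rewrite ?real0 ?rkhs_dot_real// => d d0 d1.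
have [s fs] := approx_exists fM d0.
apply: le_trans (kform_ge0 k s) _; rewrite -lerBlDl.
apply: le_trans (rkhs_dot_kform fM d0 d1 fs); apply: real_ler_norm.
by rewrite realB ?rkhs_dot_real ?ger0_real ?kform_ge0.
Qed.

(** Together with [rkhs_dot_le], this shows that the norm given by the inner product is the dual
    norm, that is, the least dual bound. *)
Lemma rkhs_dot_bound f : dual_bound k f (sqrtC (rkhs_dot f f)).
Proof.
have [M fM] := rkhs_bound f; have M0 := fM.1.
split=> [|t]; first by rewrite sqrtC_ge0 rkhs_dot_ge0.
rewrite -ler_sqr ?nnegrE ?mulr_ge0 ?sqrtC_ge0 ?rkhs_dot_ge0 ?kform_ge0//.
rewrite exprMn sqrtCK; set N := kseminorm k t.
(* The constant adds up [2 * M + 1] from replacing [<f, f>] by [|s|^2], twice [M + 1] from the cross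
   term [2 |s| d], and 1 from [d ^+ 2 <= d]. *)
apply: (@le_of_small _ _ _ ((4 * M + 4) * N ^+ 2)).
- by rewrite realX ?normr_real.
- by rewrite realM ?rkhs_dot_real// realX// ger0_real// kseminorm_ge0.
move=> d d0 d1; have [s fs] := approx_exists fM d0.
have h : `|eval f t| <= (kseminorm k s + d) * N.
  rewrite -[eval f t](subrK (kform k s t)) (le_trans (ler_normD _ _))//.
  by rewrite mulrDl addrC lerD ?kform_bound//; exact: fs.
have h2 : `|eval f t| ^+ 2 <= ((kseminorm k s + d) * N) ^+ 2.
  by rewrite ler_sqr ?nnegrE ?mulr_ge0 ?addr_ge0 ?kseminorm_ge0 ?(ltW d0).
apply: le_trans h2 _; rewrite exprMn [_ * N ^+ 2 * d]mulrAC -mulrDl.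
rewrite ler_wpM2r ?exprn_ge0 ?kseminorm_ge0//.
rewrite sqrrD sqr_kseminorm.
have e1 : kform k s s <= rkhs_dot f f + (2 * M + 1) * d.
  rewrite -lerBlDl; apply: le_trans (rkhs_dot_kform fM d0 d1 fs); apply: real_ler_norm.
  by rewrite realB ?rkhs_dot_real ?ger0_real ?kform_ge0.
have e2 : kseminorm k s * d <= (M + 1) * d.
  rewrite ler_wpM2r ?(ltW d0)//; apply: le_trans (approx_kseminorm fM (ltW d0) fs) _.
  by rewrite lerD2l.
have e3 : d ^+ 2 <= d by rewrite expr2 ger_pMr.
have -> : rkhs_dot f f + (4 * M + 4) * d =
  rkhs_dot f f + (2 * M + 1) * d + ((M + 1) * d) *+ 2 + d by ring.
by rewrite lerD// lerD// lerMn2r.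
Qed.

Lemma rkhs_dot_le f M : dual_bound k f M -> sqrtC (rkhs_dot f f) <= M.
Proof.
move=> fM; have M0 := fM.1.
rewrite -ler_sqr ?nnegrE ?sqrtC_ge0 ?rkhs_dot_ge0// sqrtCK.
apply: (@le_of_small _ _ _ (2 * M)) => [||d d0 d1]; rewrite ?rkhs_dot_real ?ger0_real ?exprn_ge0//.
have [s fs] := approx_exists fM d0.
rewrite -(ger0_norm (rkhs_dot_ge0 f)) -[rkhs_dot f f](subrK (eval f s)).
apply: le_trans (ler_normD _ _) _.
have -> : M ^+ 2 + 2 * M * d = M * d + M * (M + d) by ring.
rewrite lerD//; first by rewrite distrC; exact: rkhs_dotP.
apply: le_trans (fM.2 s) _; rewrite ler_wpM2l//.
exact: approx_kseminorm (ltW d0) fs.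
Qed.

End ReproducingKernel.

Lemma cvg_norm_le (R : realType) T (F : set_system T) (u : T -> R[i]^o) (l : R[i]^o) c :
  ProperFilter F -> u @ F --> l -> (\forall x \near F, `|u x| <= c) -> `|l| <= c.
Proof.
move=> FF ul uc; apply/ler_addgt0Pl => e e0.
move/cvgrPdist_lt : ul => /(_ _ e0) ul; have [x [ux lx]] := filter_ex (filterI uc ul).
rewrite -[l](subrK (u x)); apply: le_trans (ler_normD _ _) _.
by rewrite lerD// ltW.
Qed.

Section RkhsHilbert.
Variables (R : realType) (X : Type) (k : pskernel R X).
Local Notation C := R[i].
Implicit Types (s t : seq (C * X)) (f g h : rkhs k).

Definition rkhs_norm f : C := sqrtC (rkhs_dot f f).

Lemma rkhs_normD f g : rkhs_norm (f + g) <= rkhs_norm f + rkhs_norm g.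
Proof.
apply: rkhs_dot_le; have := dual_bound_lin 1 (rkhs_dot_bound f) (rkhs_dot_bound g).
rewrite normr1 mul1r; congr (dual_bound k _ _).
by apply/funext => x; rewrite mul1r.
Qed.

Lemma rkhs_normZ (a : C) f : rkhs_norm (a *: f) = `|a| * rkhs_norm f.
Proof.
have Z g h : rkhs_dot (a *: g) h = a * rkhs_dot g h.
  have := rkhs_dot_linear h a g 0; rewrite addr0 => ->.
  have := rkhs_dot_linear h (-1) 0 0.
  by rewrite scaler0 addr0 mulN1r addNr => ->; rewrite addr0.
rewrite /rkhs_norm Z rkhs_dotC Z rmorphM /= -rkhs_dotC mulrA -normCK.
by rewrite sqrtCM ?nnegrE ?exprn_ge0 ?rkhs_dot_ge0// sqrCK.
Qed.

Lemma rkhs_norm0_eq0 f : rkhs_norm f = 0 -> f = 0.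
Proof.
move=> f0; have [_ fb] := rkhs_dot_bound f; apply: rkhsP => x.
have := fb [:: (1, x)]; rewrite -/(rkhs_norm f) f0 mul0r eval1.
by rewrite normr_le0 => /eqP.
Qed.

HB.instance Definition _ :=
  @Lmodule_isNormed.Build C (rkhs k) rkhs_norm rkhs_normD rkhs_normZ rkhs_norm0_eq0.

Lemma rkhs_normE f : `|f| = sqrtC (rkhs_dot f f).
Proof. by []. Qed.

Lemma rkhs_eval_bound f t : `|eval f t| <= `|f| * kseminorm k t.
Proof. exact: (rkhs_dot_bound f).2. Qed.

Lemma rkhs_norm_le f M : dual_bound k f M -> `|f| <= M.
Proof. exact: rkhs_dot_le. Qed.

Lemma eval_rkhsB f g t : eval (f - g) t = eval f t - eval g t.
Proof.
rewrite -[- eval g t]mulN1r -evalZ -evalD; congr eval.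
by apply/funext => x /=; rewrite mulN1r.
Qed.

(** The pointwise limit [l] of the functionals is also a limit in dual norm, because the Cauchy
    estimates are uniform in [t] relative to its seminorm. It is bounded, as [l = f1 - (f1 - l)] for
    some [f1] at distance at most 1. *)
Lemma rkhs_complete (F : set_system (rkhs k)) : ProperFilter F -> cauchy F -> cvg F.
Proof.
move=> FF /cauchyP Fc.
have evc t : cvg ((fun f => eval f t : C^o) @ F).
  apply: complex_cauchy_cvg; apply: cauchy_exP => e e0.
  pose N := kseminorm k t + 1; have N0 : 0 < N by rewrite ltr_wpDl// kseminorm_ge0.
  have [f Ff] := Fc _ (divr_gt0 e0 N0); exists (eval f t).
  apply: (@filterS _ F _ _ _ _ Ff) => g; rewrite -!ball_normE /= => fg.
  rewrite -eval_rkhsB; apply: le_lt_trans (rkhs_eval_bound _ _) _.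
  apply: le_lt_trans (_ : `|f - g| * N < e); first by rewrite ler_wpM2l// lerDl.
  by rewrite -ltr_pdivlMr.
pose l x := lim ((fun f => f x : C^o) @ F).
have lE t : (fun f => eval f t : C^o) @ F --> eval l t.
  elim: t => [|p t IH].
    rewrite /eval big_nil (_ : (fun f => _) = fun=> 0); first exact: cvg_cst.
    by apply/funext => f; rewrite big_nil.
  rewrite /eval big_cons (_ : (fun f => _) = fun f => p.1^* * f p.2 + eval f t); last first.
    by apply/funext => f; rewrite big_cons.
  apply: cvgD; last exact: IH.
  apply: cvgMr; have := evc [:: (1, p.2)].
  by rewrite (_ : (fun f => _) = (fun f => f p.2)); last by apply/funext => f; rewrite eval1.
have lB (f : rkhs k) e : 0 < e -> F (ball f e) -> dual_bound k (fun x => f x - l x) e.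
  move=> e0 Ff; split=> [|t]; first exact: ltW.
  have fE (g : X -> C) : eval (fun x => f x - g x) t = eval f t - eval g t.
    rewrite -[- eval g t]mulN1r -evalZ -evalD; congr eval.
    by apply/funext => x /=; rewrite mulN1r.
  rewrite fE; apply: (@cvg_norm_le _ _ F (fun g => eval f t - eval g t)).
    by apply: cvgB; [exact: cvg_cst|exact: lE].
  apply: filterS Ff => g; rewrite -ball_normE /= => fg.
  rewrite -eval_rkhsB; apply: le_trans (rkhs_eval_bound _ _) _.
  by rewrite ler_wpM2r ?kseminorm_ge0// ltW.
have [f1 F1] := Fc 1 ltr01.
have lb : l \in dual_bounded k.
  have [M f1M] := rkhs_bound f1; apply/asboolP; exists (`|-1| * 1 + M).
  have := dual_bound_lin (-1) (lB _ _ ltr01 F1) f1M; congr (dual_bound k _ _).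
  by apply/funext => x; rewrite mulN1r opprB subrK.
apply/cvg_ex; exists (RKHS lb); apply/cvgrPdist_lt => e e0.
have e20 : 0 < e / 2 by rewrite divr_gt0.
have [f Ff] := Fc _ e20; apply: filterS (Ff) => g; rewrite -ball_normE /= => fg.
rewrite -(subrKA f) [e]splitr; apply: le_lt_trans (ler_normD _ _) _.
by rewrite ler_ltD// distrC; apply: rkhs_norm_le; exact: lB.
Qed.

HB.instance Definition _ := Uniform_isComplete.Build (rkhs k) rkhs_complete.

Lemma rkhs_dot_bilinear :
  bilinear_for *%R (Num.conj \; *%R : C -> C -> C) (@rkhs_dot R X k).
Proof.
split=> [g|f]; first exact: rkhs_dot_linear.
move=> a g g'; rewrite rkhs_dotC rkhs_dot_linear rmorphD rmorphM /= -!rkhs_dotC.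
by [].
Qed.

HB.instance Definition _ := bilinear_isBilinear.Build C (rkhs k) (rkhs k) C
  *%R (Num.conj \; *%R) (@rkhs_dot R X k) rkhs_dot_bilinear.

Lemma rkhs_dot_hermitian f g :
  rkhs_dot f g = (-1) ^+ false * (rkhs_dot g f)^*.
Proof. by rewrite expr0 mul1r -rkhs_dotC. Qed.

HB.instance Definition _ := isHermitianSesquilinear.Build C (rkhs k) false
  Num.conj (@rkhs_dot R X k) rkhs_dot_hermitian.

Lemma rkhs_dot_gt0 f : f != 0 -> 0 < rkhs_dot f f.
Proof.
move=> f0; rewrite lt_def rkhs_dot_ge0 andbT; apply: contra f0 => /eqP e.
by apply/eqP/rkhs_norm0_eq0; rewrite /rkhs_norm e sqrtC0.
Qed.

HB.instance Definition _ := isDotProduct.Build C (rkhs k) (@rkhs_dot R X k)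
  rkhs_dot_gt0.

Lemma rkhs_dot_norm f : rkhs_dot f f = `|f| ^+ 2.
Proof. by rewrite rkhs_normE sqrtCK. Qed.

HB.instance Definition _ :=
  NormedModule_isHilbert.Build R (rkhs k) rkhs_dot_norm.

End RkhsHilbert.

(** * Kernel vectors and the operators acting on them *)

Lemma contraction_bop (R : realType) (H K : hilbertType R) (f : H -> K) :
  linear f -> (forall x, `|f x| <= `|x|) -> exists A : 'B(H, K), forall x, A x = f x.
Proof.
move=> flin f1.
pose f' : {linear H -> K} := HB.pack f (GRing.isLinear.Build R[i] H K _ f flin).
suff fc : continuous f by exists (BOp flin fc).
apply: (@bounded_linear_continuous _ _ _ f'); apply/linear_boundedP.
exists 1; split=> [|r r1 y]; first exact: real1.
by apply: le_trans (f1 y) _; rewrite ler_peMl// ltW.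
Qed.

Lemma adj_contraction (R : realType) (H K : hilbertType R) (A : 'B(H, K)) :
  (forall x, `|A x| <= `|x|) -> forall y, `|adj A y| <= `|y|.
Proof.
move=> A1 y; apply: le_of_sqr => //; rewrite -hdot_norm -adjP.
rewrite -[leLHS]ger0_norm; last by rewrite adjP hdot_norm exprn_ge0.
by apply: le_trans (hdot_bound _ _) _; rewrite mulrC ler_wpM2l.
Qed.

Section FamilyCombinations.
Variables (R : realType) (H : hilbertType R) (X : Type) (v : X -> H).
Local Notation C := R[i].
Implicit Types s : seq (C * X).

Definition family_comb s : H := \sum_(p <- s) p.1 *: v p.2.

Lemma hdot_combl s z : '[family_comb s, z] = \sum_(p <- s) p.1 * '[v p.2, z].
Proof.
rewrite /family_comb; elim: s => [|p s IH].
  by rewrite !big_nil -(scale0r 0) hdotZl mul0r.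
by rewrite !big_cons hdotDl hdotZl IH.
Qed.

Lemma hdot_combr s z : '[z, family_comb s] = \sum_(p <- s) p.1^* * '[z, v p.2].
Proof.
rewrite hdotC hdot_combl rmorph_sum; apply: eq_bigr => p _.
by rewrite rmorphM /= -hdotC.
Qed.

End FamilyCombinations.

Lemma bop_family_comb (R : realType) (H K : hilbertType R) X (v : X -> H) (A : 'B(H, K)) s :
  A (family_comb v s) = family_comb (fun x => A (v x)) s.
Proof. by rewrite linear_sum; apply: eq_bigr => p _; rewrite linearZ. Qed.

Section KernelVectors.
Variables (R : realType) (X : Type) (k : pskernel R X).
Local Notation C := R[i].
Implicit Types (s t : seq (C * X)) (f g : rkhs k).

Lemma kernel_dual_bounded x : k x \in dual_bounded k.
Proof.
apply/asboolP; exists (kseminorm k [:: (1, x)]).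
have := dual_bound_kcomb k [:: (1, x)]; congr (dual_bound k _ _).
by apply/funext => y; rewrite /kcomb big_seq1 mul1r.
Qed.

Definition kvec x : rkhs k := RKHS (kernel_dual_bounded x).

(** The reproducing property: the one-term combination [[:: (1, x)]] represents [kvec x] exactly,
    hence approximates it within every [d]. *)
Lemma hdot_kvec f x : '[f, kvec x] = f x.
Proof.
have [M fM] := rkhs_bound f.
apply: (@eq_of_small _ _ _ M) => d d0 _; rewrite -(eval1 f x) distrC.
apply: rkhs_dotP => // t; rewrite (_ : kform _ _ _ = eval (kvec x) t).
  by rewrite subrr normr0 mulr_ge0 ?kseminorm_ge0 ?ltW.
by congr eval; apply/funext => y; rewrite /kcomb big_seq1 mul1r.
Qed.

Lemma hdot_kvec2 x y : '[kvec x, kvec y] = k x y.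
Proof. exact: hdot_kvec. Qed.

Definition vcomb s : rkhs k := family_comb kvec s.

Lemma vcombE s x : vcomb s x = kcomb k s x.
Proof.
by rewrite -hdot_kvec hdot_combl; apply: eq_bigr => p _; rewrite hdot_kvec2.
Qed.

Lemma vcomb_dense f e : 0 < e -> exists s, `|f - vcomb s| <= e.
Proof.
move=> e0; have [M fM] := rkhs_bound f; have [s fs] := approx_exists fM e0.
exists s; apply: rkhs_norm_le; have /approxE := fs; move=> /(_ (ltW e0)).
by congr (dual_bound k _ _); apply/funext => x; rewrite -vcombE.
Qed.

(** After passing to adjoints, agreement on the kernel vectors is pointwise equality of the
    functions [adj A v] and [adj B v], so density is not invoked. *)
Lemma bop_kvec_ext (L : hilbertType R) (A B : 'B(rkhs k, L)) :
  (forall x, A (kvec x) = B (kvec x)) -> A = B.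
Proof.
move=> e; apply/bopP => f; apply: hdot_ext => v; rewrite !adjP.
suff -> : adj A v = adj B v by [].
by apply: rkhsP => x; rewrite -!hdot_kvec hdotC -adjP e adjP -hdotC.
Qed.

(** Composition with [tau] is well defined on functions and contractive by assumption; its adjoint
    is the operator sought, as [f (tau x)] is the inner product of [f] with [kvec (tau x)]. No
    well-definedness on the span has to be checked. *)
Lemma kvec_operator (tau : X -> X) :
  (forall s, kform k (map_comb tau s) (map_comb tau s) <= kform k s s) ->
  exists2 A : 'B(rkhs k), (forall x, A (kvec x) = kvec (tau x)) &
    forall f, `|A f| <= `|f|.
Proof.
move=> tau1.
have tau_bound f : dual_bound k (f \o tau) `|f|.
  split=> // t; rewrite -eval_map; apply: le_trans (rkhs_eval_bound _ _) _.
  by rewrite ler_wpM2l// ler_sqrtC ?nnegrE ?kform_ge0// tau1.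
have tau_b f : f \o tau \in dual_bounded k by apply/asboolP; exists `|f|.
have [|f|B BE] := @contraction_bop R (rkhs k) (rkhs k) (fun f => RKHS (tau_b f)).
- by move=> a f g; apply: rkhsP.
- by apply: rkhs_norm_le; exact: tau_bound.
exists (adj B).
  by move=> x; apply: hdot_extr => f; rewrite -adjP BE !hdot_kvec.
by apply: adj_contraction => f; rewrite BE; apply: rkhs_norm_le; exact: tau_bound.
Qed.

End KernelVectors.

(** * Fuglede's theorem *)

Lemma archimedean_le0 (R : realType) (d M : R[i]) : d \is Num.real ->
  (forall n, n%:R * d <= M) -> d <= 0.
Proof.
move=> dr dM; have [//|d0] := real_leP dr (real0 _).
have M0 : 0 <= M by apply: le_trans (dM 0); rewrite mul0r.
have [q q0 qE] : exists2 q, 0 < q & M / d + 1 = q%:C%C.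
  by apply: gt0_complexE; rewrite ltr_wpDl// divr_ge0// ltW.
have := dM (Num.bound q); rewrite -ler_pdivlMr// => h.
have : (Num.bound q)%:R < q%:C%C by rewrite -qE (le_lt_trans h)// ltrDl.
rewrite -(rmorph_nat (real_complex R)) ltcR => /(lt_trans (archi_boundP (ltW q0))).
by rewrite ltxx.
Qed.

Lemma closed_primitive_root (F : numClosedFieldType) n :
  (0 < n)%N -> exists z : F, n.-primitive_root z.
Proof.
move=> n0; have [rs] := closed_field_poly_normal ('X^n - 1 : {poly F}).
rewrite (monicP _) ?monicXnsubC// scale1r => rsE.
have nrs : all n.-unity_root rs by apply/allP=> z; rewrite -root_prod_XsubC -rsE.
have urs : uniq rs by rewrite -separable_prod_XsubC -rsE separable_Xn_sub_1// pnatr_eq0 -lt0n.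
have srs : (n <= size rs)%N by rewrite -ltnS -(size_prod_XsubC rs id) -rsE size_XnsubC.
by have /hasP[z _ zn] := has_prim_root n0 nrs urs srs; exists z.
Qed.

Lemma sum_primitive_root (F : fieldType) n (z : F) j : n.-primitive_root z ->
  ~~ (n %| j)%N -> \sum_(i < n) z ^+ (i * j) = 0.
Proof.
move=> zn nj; have zj : z ^+ j - 1 != 0.
  by rewrite subr_eq0 -(prim_order_dvd zn).
have : (z ^+ j) ^+ n - 1 = 0.
  by rewrite -exprM mulnC exprM (prim_expr_order zn) expr1n subrr.
move/eqP; rewrite subrX1 mulf_eq0 (negbTE zj) => /eqP s0.
by rewrite -[RHS]s0; apply: eq_bigr => i _; rewrite -exprM mulnC.
Qed.

(* Averaging over the [N]-th roots of unity isolates the linear coefficient. *)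
Lemma cauchy_estimate (R : realType) (V : normedModType R[i]) (c : nat -> V) N (r B : R[i]) :
  (1 < N)%N -> 0 <= r ->
  (forall t, `|t| = r -> `|\sum_(k < N) t ^+ k *: c k| <= B) -> r * `|c 1| <= B.
Proof.
move=> N1 r0 uB; have N0 : (0 < N)%N by exact: ltnW.
have [z zN] := closed_primitive_root R[i] N0.
have z1 : `|z| = 1.
  apply/eqP; rewrite -(@pexpr_eq1 _ _ N)// -normrX (prim_expr_order zN).
  by rewrite normr1.
(* The weight [z ^+ (i * N.-1)] is the inverse of [z ^+ i]. For [k < N] the exponent [N.-1 + k] is
   divisible by [N] only when [k = 1], so all other coefficients average to 0. *)
have E : \sum_(i < N) z ^+ (i * N.-1) *: \sum_(k < N) (r * z ^+ i) ^+ k *: c k =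
    (N%:R * r) *: c 1%N.
  under eq_bigr => i _ do rewrite scaler_sumr.
  rewrite exchange_big /= (bigD1 (Ordinal N1)) //= [X in _ + X]big1 ?addr0.
    rewrite (eq_bigr (fun=> r *: c 1%N)) => [|i _].
      by rewrite sumr_const card_ord -scaler_nat scalerA.
    rewrite expr1 scalerA mulrCA -exprD -mulnSr prednK//.
    by rewrite mulnC exprM (prim_expr_order zN) expr1n mulr1.
  move=> k kN; transitivity ((r ^+ k * \sum_(i < N) z ^+ (i * (N.-1 + k))) *: c k).
    rewrite mulr_sumr scaler_suml; apply: eq_bigr => i _.
    by rewrite scalerA exprMn -exprM mulrCA -exprD -mulnDr.
  rewrite sum_primitive_root ?mulr0 ?scale0r//.
  have k1 : k != 1%N :> nat by [].
  have kN' := ltn_ord k; case: (nat_of_ord k) k1 kN' => [_ _|[//|j _ jN]].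
    by rewrite addn0 gtnNdvd ?prednK// -ltnS prednK.
  by rewrite addnS -addSn prednK// dvdn_addr// gtnNdvd// (ltnW jN).
have Npos : 0 < N%:R :> R[i] by rewrite ltr0n.
rewrite -(ler_pM2l Npos) mulrA -[N%:R * r]ger0_norm ?mulr_ge0 ?ler0n// -normrZ -E.
apply: le_trans (ler_norm_sum _ _ _) _.
rewrite mulr_natl -[in leRHS](card_ord N) -sumr_const ler_sum// => i _.
rewrite normrZ normrX z1 expr1n mul1r; apply: uB.
by rewrite normrM normrX z1 expr1n mulr1 ger0_norm.
Qed.

(** With [e] the added fraction, Bernoulli's inequality gives [(1 - e) ^+ n.+1 >= 1/2], while
    [(1 + e) (1 - e) <= 1]. *)
Lemma one_plus_half_inv_exp (R : numFieldType) n : (1 + (2 * n.+1%:R)^-1) ^+ n.+1 <= 2 :> R.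
Proof.
set e : R := (2 * n.+1%:R)^-1; have e0 : 0 < e by rewrite invr_gt0 mulr_gt0.
have e1 : e <= 1.
  by rewrite invf_le1 ?mulr_gt0// -natrM ler1n muln_gt0.
have bern m : 1 - m%:R * e <= (1 - e) ^+ m.
  elim: m => [|m IH]; first by rewrite mul0r subr0.
  have h : (1 - m%:R * e) * (1 - e) <= (1 - e) ^+ m.+1.
    by rewrite exprSr ler_wpM2r// subr_ge0.
  apply: le_trans h; rewrite -subr_ge0.
  have -> : (1 - m%:R * e) * (1 - e) - (1 - m.+1%:R * e) = m%:R * e ^+ 2.
    by rewrite -addn1 natrD; ring.
  by rewrite mulr_ge0// exprn_ge0// ltW.
have half : 2^-1 <= (1 - e) ^+ n.+1.
  apply: le_trans (bern _); have n0 : n.+1%:R != 0 :> R by rewrite pnatr_eq0.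
  have -> // : 1 - n.+1%:R * e = 2^-1.
  by rewrite /e invfM mulrCA mulfV// mulr1 {1}(splitr 1) div1r addrK.
have h : (1 + e) ^+ n.+1 * (1 - e) ^+ n.+1 <= 1.
  rewrite -exprMn exprn_ile1//.
    by rewrite mulr_ge0 ?subr_ge0// addr_ge0 ?(ltW e0).
  rewrite (_ : _ * _ = 1 - e ^+ 2); last by ring.
  by rewrite lerBlDr lerDl exprn_ge0// ltW.
have := le_trans (ler_wpM2l (exprn_ge0 n.+1 (addr_ge0 ler01 (ltW e0))) half) h.
by rewrite ler_pdivrMr// mul1r.
Qed.

Lemma iter_commute T (f g : T -> T) n x : (forall y, f (g y) = g (f y)) ->
  iter n f (g x) = g (iter n f x).
Proof. by move=> fg; elim: n => //= n ->. Qed.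

(* With [S t = 1 + t B^*], normality of [B] and [A B = B A] give
   [|S t^n A S (-t)^n x| <= |S t^n S (-t)^n x| <= (1 + |t|^2)^n |x|]. The left-hand
   side is the norm of a polynomial in [t] whose linear coefficient is
   [n (B^* A x - A B^* x)]. *)
Section Fuglede.
Variables (R : realType) (K : hilbertType R) (A B : 'B(K)).
Hypotheses (normalB : normal_op B) (A1 : forall x, `|A x| <= `|x|).
Hypotheses (B1 : forall x, `|B x| <= `|x|) (AB : forall x, A (B x) = B (A x)).
Local Notation C := R[i].
Local Notation Bs := (adj B).

Lemma normal_commute x : B (Bs x) = Bs (B x).
Proof. by have := normalB => /bopP /(_ x). Qed.

Let S (t : C) y := y + t *: Bs y.
Let S' (t : C) y := y + t^* *: B y.

Let SS' t y : S t (S' t y) = S' t (S t y).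
Proof.
rewrite /S /S' !linearD !linearZ /= normal_commute.
by rewrite !scalerA (mulrC t) addrACA.
Qed.

Let S_S t u y : S t (S u y) = S u (S t y).
Proof.
by rewrite /S !linearD !linearZ /= !scalerA (mulrC t) addrACA.
Qed.

Let norm_S t y : `|S t y| = `|S' t y|.
Proof.
apply/eqP; rewrite -(eqrXn2 (ltn0Sn 1))//; apply/eqP; rewrite !hnormDE.
have nB : `|Bs y| ^+ 2 = `|B y| ^+ 2 
  by rewrite -!hdot_norm -adjP normal_commute hdotC -adjP -hdotC.
rewrite !normrZ norm_conjC !exprMn nB; congr (_ + _ + _).
by rewrite !hdotZr conjCK -adjP (hdotC y (B y)) !rmorphM /= !conjCK addrC.
Qed.

Let norm_iterS t n y : `|iter n (S t) y| = `|iter n (S' t) y|.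
Proof.
elim: n y => //= n IH y; rewrite norm_S -iter_commute; last exact: SS'.
by rewrite IH -iterSr.
Qed.

(** [A] is only known to commute with [B]; normality trades [S], built from [adj B], for [S'], built
    from [B], without changing norms. *)
Let norm_iterSA t n y : `|iter n (S t) (A y)| <= `|iter n (S t) y|.
Proof.
rewrite !norm_iterS; suff -> : iter n (S' t) (A y) = A (iter n (S' t) y) by [].
by apply: iter_commute => z; rewrite /S' linearD linearZ /= AB.
Qed.

Let norm_iterSS t n x :
  `|iter n (S t) (iter n (S (- t)) x)| <= (1 + `|t| ^+ 2) ^+ n * `|x|.
Proof.
elim: n x => [|n IH] x; first by rewrite mul1r.
have -> : iter n.+1 (S t) (iter n.+1 (S (- t)) x) =
    S t (S (- t) (iter n (S t) (iter n (S (- t)) x))).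
  by rewrite !iterS iter_commute//; exact: S_S.
set y := iter n _ _.
have -> : S t (S (- t) y) = y - t ^+ 2 *: Bs (Bs y).
  rewrite /S linearD linearZ /= scalerDr scalerA mulrN scaleNr -expr2.
  by rewrite scaleNr addrA subrK.
apply: le_trans (ler_normB _ _) _.
rewrite (exprS _ n) -mulrA; apply: (@le_trans _ _ ((1 + `|t| ^+ 2) * `|y|)); last first.
  by rewrite ler_wpM2l ?addr_ge0 ?exprn_ge0//; exact: IH.
rewrite mulrDl mul1r lerD2l normrZ normrX ler_wpM2l ?exprn_ge0//.
by apply: le_trans (adj_contraction B1 _) (adj_contraction B1 _).
Qed.

(** A polynomial in [t] of degree less than [n], of which only the constant and linear coefficients
    are recorded. *)
Let poly_in n (u : C -> K) (c0 c1 : K) := exists c : nat -> K,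
  [/\ c 0%N = c0, c 1%N = c1, (forall j, (n <= j)%N -> c j = 0) &
      forall t, u t = \sum_(j < n) t ^+ j *: c j].

Let poly_iterS e m n u c0 c1 : (0 < n)%N -> poly_in n u c0 c1 ->
  poly_in (m + n) (fun t => iter m (S (e * t)) (u t)) c0 (c1 + (m%:R * e) *: Bs c0).
Proof.
move=> n0 h; elim: m => [|m [c [e0 e1 cn uE]]].
  rewrite mul0r scale0r addr0; exact: h.
exists (fun j => c j + (if j is i.+1 then e *: Bs (c i) else 0)); split.
- by rewrite e0 addr0.
- by rewrite e0 e1 -natr1 mulrDl mul1r scalerDl addrA.
- case=> [|j] //; rewrite addSn ltnS => mj; rewrite !cn ?linear0 ?scaler0 ?addr0//.
  exact: leq_trans mj _.
move=> t; rewrite iterS uE /S linear_sum addSn; set N := (m + n)%N.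
under [RHS]eq_bigr => j _ do rewrite scalerDr.
rewrite [RHS]big_split /= big_ord_recr /= cn// scaler0 addr0; congr (_ + _).
rewrite big_ord_recl /= scaler0 add0r scaler_sumr; apply: eq_bigr => j _.
by rewrite linearZ /= !scalerA exprS; congr (_ *: _); ring.
Qed.

Let poly_A n u c0 c1 : poly_in n u c0 c1 -> poly_in n (A \o u) (A c0) (A c1).
Proof.
move=> [c [e0 e1 cn uE]]; exists (A \o c); split; rewrite /= ?e0 ?e1//.
  by move=> j /cn ->; rewrite linear0.
by move=> t; rewrite /= uE linear_sum; apply: eq_bigr => j _; rewrite linearZ.
Qed.

Lemma fuglede x : Bs (A x) = A (Bs x).
Proof.
apply/eqP; rewrite -subr_eq0 -normr_eq0; apply/eqP.
set D := _ - _.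
(* For [r = 1 / (2 (m + 1))] and [n = 2 (m + 1)^2], [(1 + r^2)^n <= 2] while
   [n r = m + 1]. *)
have est m : m.+1%:R * `|D| <= 2 * `|x|.
  have [a aE] : exists a : C, a = m.+1%:R by exists m.+1%:R.
  pose r := (2 * a)^-1.
  have a0 : a != 0 by rewrite aE pnatr_eq0.
  have [n nE n0] : exists2 n, n%:R = 2 * a ^+ 2 & (0 < n)%N.
    by exists (2 * m.+1 ^ 2)%N; rewrite ?muln_gt0 ?expn_gt0// natrM natrX aE.
  have p0 : poly_in 1 (fun=> x) x 0.
    exists (fun j => if j is 0%N then x else 0); split=> //; first by case.
    by move=> t; rewrite big_ord1 scale1r.
  have /(poly_iterS 1 n) := poly_A (poly_iterS (-1) n (ltnSn 0) p0).
  rewrite addn1 => /(_ isT) [c [_ c1 _ uE]].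
  have c1E : c 1%N = n%:R *: D.
    by rewrite c1 add0r mulr1 mulrN1 scaleNr linearN linearZ /= addrC -scalerBr.
  have r0 : 0 < r by rewrite invr_gt0 mulr_gt0// aE ltr0n.
  have rn : r * n%:R = a by rewrite nE /r; field.
  have r2 : r ^+ 2 = (2 * n%:R)^-1 by rewrite nE /r; field.
  have nn : (1 < n + n.+1)%N by rewrite addnS ltnS ltn_addl.
  rewrite -aE -rn -[n%:R]normr_nat -mulrA -normrZ -c1E.
  apply: (cauchy_estimate nn (ltW r0)) => t tr.
  rewrite -uE /= mul1r mulN1r; apply: le_trans (norm_iterSA _ _ _) _.
  apply: le_trans (norm_iterSS _ _ _) _; rewrite ler_wpM2r// tr r2.
  by rewrite -(prednK n0); exact: one_plus_half_inv_exp.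
apply/eqP; rewrite eq_le normr_ge0 andbT.
apply: (@archimedean_le0 _ _ (2 * `|x|)) => [|[|m]]; rewrite ?normr_real//.
by rewrite mul0r mulr_ge0.
Qed.

End Fuglede.

(** * Star-commuting representations of lattice ordered semigroups *)

Section Meet.
Local Open Scope group_scope.
Variables (G : groupType) (P : set G).
Hypothesis losP : lattice_ordered_semigroup P.
Implicit Types a p q u v w : G.

Lemma ple_refl p : ple P p p.
Proof. by rewrite /ple mulVg; exact: los1 losP. Qed.

Lemma ple_trans q p w : ple P p q -> ple P q w -> ple P p w.
Proof.
by move=> pq qw; have := losM losP pq qw; rewrite mulgA mulgK.
Qed.

Definition meet p q := projT1 (cid (los_meet losP p q)).

Lemma meetP p q : is_meet P p q (meet p q).
Proof. by rewrite /meet; case: cid. Qed.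

Lemma ple_meet v p q : ple P v (meet p q) <-> ple P v p /\ ple P v q.
Proof.
have [mp mq mm] := meetP p q.
by split=> [vm|[]]; [split; apply: ple_trans vm _|exact: mm].
Qed.

Lemma meetl p q : ple P (meet p q) p.
Proof. by case: (meetP p q). Qed.

Lemma meetr p q : ple P (meet p q) q.
Proof. by case: (meetP p q). Qed.

Lemma meet_eq p q u : (forall v, ple P v u <-> ple P v p /\ ple P v q) -> meet p q = u.
Proof.
move=> h; apply: (ple_anti losP).
  by apply/h; split; [exact: meetl|exact: meetr].
by apply/ple_meet/h; exact: ple_refl.
Qed.

Lemma is_meet_eq p q u : is_meet P p q u -> meet p q = u.
Proof.
move=> [up uq um]; apply: meet_eq => v.
by split=> [vu|[]]; [split; exact: ple_trans vu _|exact: um].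
Qed.

Lemma meet_ple p q : ple P p q -> meet p q = p.
Proof.
by move=> pq; apply: meet_eq => v; split=> [vp|[]//]; split=> //; exact: ple_trans pq.
Qed.

Lemma meetC p q : meet p q = meet q p.
Proof. by apply: meet_eq => v; rewrite ple_meet; split=> -[]. Qed.

Lemma meetA p q u : meet (meet p q) u = meet p (meet q u).
Proof.
apply: meet_eq => v; rewrite !ple_meet; split=> [[? []]//|[[? ?] ?]]; by split.
Qed.

Lemma ple_mulg a p q : ple P (a * p) (a * q) <-> ple P p q.
Proof. by rewrite /ple invgM mulgA mulgVK. Qed.

Lemma meet_mulg a p q : meet (a * p) (a * q) = a * meet p q.
Proof.
apply: meet_eq => v; rewrite -[v](mulVKg a) !ple_mulg; exact: ple_meet.
Qed.

Lemma ple_mull_P a p : P a -> ple P p (a * p).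
Proof. by move=> /(los_normal losP p^-1); rewrite /ple invgK mulgA. Qed.

End Meet.

(* The sequence [f (A^n h) (A^n h)] is convex and bounded, hence nonincreasing. *)
Lemma form_contraction (R : realType) (K : hilbertType R) (f : K -> K -> R[i])
    (A : 'B(K)) (c : R[i]) :
  (forall a h h' y, f (a *: h + h') y = a * f h y + f h' y) ->
  (forall h y, f h y = (f y h)^*) -> (forall h, 0 <= f h h) ->
  (forall h y, f (A h) y = f h (adj A y)) -> normal_op A ->
  (forall h, `|A h| <= `|h|) -> 0 <= c -> (forall h, f h h <= c * `|h| ^+ 2) ->
  forall h, f (A h) (A h) <= f h h.
Proof.
move=> flin fC f0 fA nA A1 c0 fc h.
pose a n := f (iter n A h) (iter n A h).
have fA' u v : f (adj A u) v = f u (A v) by rewrite fC -fA -fC.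
have AA u : A (adj A u) = adj A (A u) by have := nA => /bopP /(_ u).
have convex n : 0 <= a n + a n.+2 - 2 * a n.+1.
  rewrite /a !iterS; set y := iter n A h.
  have flinN u v w : f (u - v) w = f u w - f v w.
    by rewrite -scaleN1r addrC flin mulN1r addrC.
  have flinNr u v w : f w (u - v) = f w u - f w v.
    by rewrite fC flinN rmorphB /= -!fC.
  (* By normality the form at this vector expands to the second difference of [a] at [n]. *)
  have := f0 (y - adj A (A y)).
  rewrite flinN !flinNr !fA' AA -!fA.
  by congr (0 <= _); ring.
have real_a n : a n \is Num.real by rewrite ger0_real// f0.
rewrite -[f h h]/(a 0) -[f (A h) (A h)]/(a 1) -subr_le0.
apply: (@archimedean_le0 _ _ (c * `|h| ^+ 2)) => [|n]; first by rewrite realB.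
have incr m : a 1 - a 0 <= a m.+1 - a m.
  elim: m => // m /le_trans; apply; rewrite -subr_ge0.
  by have := convex m; congr (0 <= _); ring.
have nA1 m : `|iter m A h| <= `|h| by elim: m => //= m /(le_trans (A1 _)).
have an m : m%:R * (a 1 - a 0) <= a m.
  elim: m => [|m IH]; first by rewrite mul0r f0.
  rewrite -natr1 mulrDl mul1r -[leRHS](subrK (a m)) addrC.
  by rewrite lerD.
apply: le_trans (an n) _; apply: le_trans (fc _) _.
by rewrite ler_wpM2l// ler_sqr ?nnegrE// nA1.
Qed.

(** The label type [L] is arbitrary, so that the same translation serves the kernels of both
    implications. *)
Definition shift (G : groupType) L (a : G) (x : G * L) := ((a * x.1)%g, x.2).

Section KernelPositivity.
Local Open Scope group_scope.
Variables (R : realType) (G : groupType) (P : set G).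
Hypothesis losP : lattice_ordered_semigroup P.
Variables (K : hilbertType R) (N : G -> 'B(K)).
Hypothesis repN : representation P N.
Hypothesis normalN : normal_rep P N.
Hypothesis contrN : forall p, P p -> forall h, (`|N p h| <= `|h|)%R.
Hypothesis commN : forall p q, P p -> P q -> forall h, N p (N q h) = N q (N p h).
Hypothesis dcommN : forall p q, P p -> P q -> forall h,
  adj (N p) (N q h) = N q (adj (N p) h).
Local Notation meet := (meet losP).
Implicit Types (p q u v w a : G) (F : seq G) (x y : G * K) (s : seq (G * K)).

Lemma repN_trans u v w h : ple P u v -> ple P v w ->
  N (u^-1 * v) (N (v^-1 * w) h) = N (u^-1 * w) h.
Proof.
move=> uv vw; have -> : u^-1 * w = (u^-1 * v) * (v^-1 * w) by rewrite mulgA mulgK.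
by rewrite (repN.2 _ _ uv vw).
Qed.

Lemma repN_id u h : N (u^-1 * u) h = h.
Proof. by rewrite mulVg repN.1. Qed.

(* A pair [(p, h)] stands for the vector [U p h] of the dilation to be built, so
   [dilk] is the Gram kernel of these vectors and [lower q] is the orthogonal
   projection onto the span of the [U p h] with [p <= q]. *)
Definition lower q x : G * K := (meet x.1 q, N ((meet x.1 q)^-1 * x.1) x.2).

Definition dilk x y : R[i] :=
  let m := meet x.1 y.1 in '[N (m^-1 * x.1) x.2, N (m^-1 * y.1) y.2].

(* The form of the product of the commuting projections [1 - lower q], [q] in [F]. *)
Fixpoint dilB F x y : R[i] :=
  if F is q :: F' then (dilB F' x y - dilB F' (lower q x) (lower q y))%R
  else dilk x y.

Lemma lower_id q x : ple P x.1 q -> lower q x = x.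
Proof. by case: x => p h /= pq; rewrite /lower /= meet_ple// repN_id. Qed.

Lemma lower_lower q q' x : lower q (lower q' x) = lower (meet q' q) x.
Proof.
rewrite /lower /= meetA; congr pair; apply: repN_trans; last exact: meetl.
by rewrite -meetA; exact: meetl.
Qed.

Lemma lowerC q q' x : lower q (lower q' x) = lower q' (lower q x).
Proof. by rewrite !lower_lower meetC. Qed.

Lemma lower_ple q q' x : ple P q q' -> lower q (lower q' x) = lower q x.
Proof. by move=> qq'; rewrite lower_lower meetC meet_ple. Qed.

Lemma dilkC x y : dilk x y = (dilk y x)^*.
Proof. by rewrite /dilk meetC -hdotC. Qed.

(** The identity [<E u, v> = <E u, E v>] of an orthogonal projection [E]: once [x] is lowered below
    [q], its meet with [y] is already below [q]. *)
Lemma dilk_lowerl q x y : dilk (lower q x) y = dilk (lower q x) (lower q y).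
Proof.
rewrite /dilk /=; have -> : meet (meet x.1 q) (meet y.1 q) = meet (meet x.1 q) y.1.
  by rewrite -meetA; apply: meet_ple; apply: ple_trans (meetl _ _ _) (meetr _ _ _).
rewrite (repN_trans (v := meet y.1 q))//; last exact: meetl.
by apply/ple_meet; split; [exact: meetr|apply: ple_trans (meetl _ _ _) (meetr _ _ _)].
Qed.

Lemma dilBC F x y : dilB F x y = (dilB F y x)^*.
Proof.
elim: F x y => [|q F IH] x y /=; first exact: dilkC.
by rewrite rmorphB /= -!IH.
Qed.

Lemma dilB_lowerl F q x y : dilB F (lower q x) y = dilB F (lower q x) (lower q y).
Proof.
elim: F x y => [|p F IH] x y /=; first exact: dilk_lowerl.
by rewrite IH; congr (_ - _)%R; rewrite !(lowerC p q) IH.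
Qed.

Lemma dilB_kill q F x y : ple P x.1 q -> dilB (q :: F) x y = 0%R.
Proof. by move=> xq /=; rewrite -dilB_lowerl lower_id// subrr. Qed.

Lemma dilB_killr q F x y : ple P y.1 q -> dilB (q :: F) x y = 0%R.
Proof. by move=> yq; rewrite dilBC dilB_kill// conjC0. Qed.

Lemma dilB_middle F1 q F2 x y : dilB (F1 ++ q :: F2) x y = dilB (q :: F1 ++ F2) x y.
Proof.
elim: F1 x y => [//|p F1 IH] x y; rewrite [LHS]/= !IH /= !(lowerC p q).
by ring.
Qed.

Lemma lower_shift a q x : lower (a * q) (shift a x) = shift a (lower q x).
Proof. by rewrite /lower /shift /= meet_mulg invgM -!mulgA mulKg. Qed.

Lemma dilB_shift a F x y :
  dilB [seq a * q | q <- F] (shift a x) (shift a y) = dilB F x y.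
Proof.
elim: F x y => [|q F IH] x y /=; last by rewrite !lower_shift !IH.
by rewrite /dilk /= meet_mulg invgM -!mulgA !mulKg.
Qed.

Definition act (A : 'B(K)) x : G * K := (x.1, A x.2).

Lemma dilB_act (A : 'B(K)) F x y :
  (forall p, P p -> forall h, N p (A h) = A (N p h)) ->
  (forall p, P p -> forall h, N p (adj A h) = adj A (N p h)) ->
  dilB F (act A x) y = dilB F x (act (adj A) y).
Proof.
move=> NA NA'; elim: F x y => [|q F IH] x y /=.
  rewrite /dilk /act /= NA; last by case: (meetP losP x.1 y.1).
  by rewrite adjP NA'//; case: (meetP losP x.1 y.1).
have low (B : 'B(K)) (z : G * K) : (forall p, P p -> forall h, N p (B h) = B (N p h)) ->
    lower q (act B z) = act B (lower q z).
  by move=> NB; rewrite /lower /act /= NB//; exact: meetl.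
by rewrite !low// !IH.
Qed.

Lemma dilB_lin F p (c : R[i]) h h' y :
  dilB F (p, c *: h + h')%R y = (c * dilB F (p, h) y + dilB F (p, h') y)%R.
Proof.
elim: F p h h' y => [|q F IH] p h h' y /=.
  by rewrite /dilk /= linearD linearZ /= hdotDl hdotZl.
have -> : lower q (p, c *: h + h')%R =
    (meet p q, c *: (lower q (p, h)).2 + (lower q (p, h')).2)%R.
  by rewrite /lower /= linearP.
by rewrite !IH mulrBr opprD addrACA.
Qed.

(** A crude bound suffices, since [form_contraction] asks only for some constant. *)
Lemma dilB_bound F x y : (`|dilB F x y| <= 2 ^+ size F * (`|x.2| * `|y.2|))%R.
Proof.
have N1 p q h : (`|N ((meet p q)^-1 * p) h| <= `|h|)%R 
    by apply: contrN; exact: (meetl losP p q).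
elim: F x y => [|q F IH] x y /=.
  rewrite mul1r; apply: le_trans (hdot_bound _ _) _.
  by rewrite ler_pM// ?N1// meetC N1.
apply: le_trans (ler_normB _ _) _; rewrite exprS -mulrA mulr_natl mulr2n lerD//.
apply: le_trans (IH _ _) _; rewrite ler_wpM2l ?exprn_ge0//.
by rewrite ler_pM// N1.
Qed.

Definition dilB_pos F := forall p h, (0 <= dilB F (p, h) (p, h))%R.

(** The difference of the two sides is the form [dilB (q :: F)] at [lower q' (p, h)], because
    lowering by [q'] and then by [q] is lowering by [q]. *)
Lemma dilB_head_mono F q q' p h : dilB_pos (q :: F) -> ple P q q' ->
  (dilB (q' :: F) (p, h) (p, h) <= dilB (q :: F) (p, h) (p, h))%R.
Proof.
move=> pos qq'; rewrite -subr_ge0; set x := (p, h).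
have := pos (lower q' x).1 (lower q' x).2; rewrite -surjective_pairing /=.
by rewrite lower_ple//; congr (_ <= _)%R; ring.
Qed.

(** The elements of [F] are replaced one at a time, each being brought to the head by [dilB_middle].
    All lists involved have length [n], which is what the induction in [dilB_ge0] can supply. *)
Lemma dilB_mono n F F0 a p h : (forall F', size F' = n -> dilB_pos F') ->
  (size F + size F0)%N = n -> P a ->
  (dilB ([seq (a * q)%g | q <- F] ++ F0) (p, h) (p, h) <= dilB (F ++ F0) (p, h) (p, h))%R.
Proof.
move=> pos + Pa; elim: F F0 => [//|q F IH] F0 sF.
have sF' : size (q :: [seq a * q | q <- F] ++ F0) = n.
  by rewrite -sF /= size_cat size_map.
apply: le_trans (dilB_head_mono p h (pos _ sF') (ple_mull_P losP q Pa)) _.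
by rewrite cat_cons -!dilB_middle; apply: IH; rewrite -sF /= addnS.
Qed.

(* With [m] the meet of [p] and [q] and [A = N (m^-1 p)], the term removed by [q] is
   the form at [(m, A h)]. It is at most the form at [(m, h)] because [A] is a
   contraction, and translating by [p m^-1], which only enlarges the elements of [F],
   bounds the latter by the form at [(p, h)]. *)
Lemma dilB_ge0 F : dilB_pos F.
Proof.
have [n sF] := ubnP (size F).
elim: n F sF => // n IHn [|q F] sF p h.
  by rewrite /= /dilk /= hdot_norm exprn_ge0.
have pos F' : size F' = size F -> dilB_pos F' by move=> sF'; apply: IHn; rewrite sF'.
set m := meet p q; have mp : ple P m p by exact: meetl.
rewrite /= subr_ge0 /lower /= -/m; pose A := N (m^-1 * p).
have Pa : P (p * m^-1) by have := los_normal losP m mp; rewrite mulVKg.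
have h1 := @form_contraction R K (fun h h' : K => dilB F (m, h) (m, h')) A (2 ^+ size F)%R.
apply: le_trans (h1 _ _ _ _ _ _ _ _ h) _.
- by move=> c u u' v; exact: dilB_lin.
- by move=> u v; exact: dilBC.
- by move=> u; apply: pos.
- move=> u v; apply: (@dilB_act A F (m, u) (m, v)) => r Pr k; rewrite /A.
    by rewrite commN.
  by rewrite dcommN.
- exact: normalN.
- by move=> u; apply: contrN.
- by rewrite exprn_ge0.
- move=> u; apply: le_trans (real_ler_norm (ger0_real (pos F _ _ _))) _ => //.
  by apply: le_trans (dilB_bound _ _ _) _; rewrite expr2.
rewrite -(@dilB_shift (p * m^-1)) /shift /= mulgVK -[X in dilB X]cats0 -[in leRHS](cats0 F).
by apply: (dilB_mono _ _ pos); rewrite // addn0.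
Qed.

(** The scalars of a formal combination are absorbed into the [K]-components, so plain lists of
    pairs suffice. *)
Definition dilS F s := (\sum_(x <- s) \sum_(y <- s) dilB F x y)%R.

Lemma dilS_perm F s t : perm_eq s t -> dilS F s = dilS F t.
Proof.
move=> st; rewrite /dilS (perm_big _ st) /=; apply: eq_bigr => x _.
exact: perm_big.
Qed.

Lemma dilS_kill q F x s : ple P x.1 q -> dilS (q :: F) (x :: s) = dilS (q :: F) s.
Proof.
move=> xq; rewrite /dilS big_cons [X in (X + _)%R]big1 ?add0r => [|y _].
  by apply: eq_bigr => y _; rewrite big_cons dilB_killr// add0r.
exact: dilB_kill.
Qed.

(** The orthogonal decomposition of the identity into [1 - lower q] and [lower q]. *)
Lemma dilS_split q F s : dilS F s = (dilS (q :: F) s + dilS F [seq lower q x | x <- s])%R.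
Proof.
rewrite {3}/dilS big_map -big_split /=; apply: eq_bigr => x _.
by rewrite big_map -big_split /=; apply: eq_bigr => y _; rewrite subrK.
Qed.

Lemma dilS_merge F p h h' s :
  dilS F ((p, h) :: (p, h') :: s) = dilS F ((p, h + h')%R :: s).
Proof.
have linl y : dilB F (p, (h + h')%R) y = (dilB F (p, h) y + dilB F (p, h') y)%R.
  by have := dilB_lin F p 1%R h h' y; rewrite scale1r mul1r.
have linr y : dilB F y (p, (h + h')%R) = (dilB F y (p, h) + dilB F y (p, h'))%R.
  by rewrite dilBC linl rmorphD /= -!dilBC.
rewrite /dilS big_cons [X in (_ + X = _)%R]big_cons [in RHS]big_cons addrA -big_split /=.
congr (_ + _)%R.
  by under eq_bigr => y _ do rewrite -linl; rewrite !big_cons linr addrA.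
by apply: eq_bigr => y _; rewrite !big_cons linr addrA.
Qed.

(* Splitting along the projection [lower p] removes [(p, h)] from one part; in the
   other part a second splitting either removes the second vector or merges it with
   the first one, so the number of vectors decreases in all cases. *)
Lemma dilS_ge0 F s : (0 <= dilS F s)%R.
Proof.
suff pos n x t : size t = n -> (0 <= dilS F (x :: t))%R.
  by case: s => [|x t]; [rewrite /dilS big_nil|exact: pos].
elim: n x t F => [|n IH] [p h] [|[q k] t] F //= st.
  by rewrite /dilS !big_seq1; exact: dilB_ge0.
rewrite (dilS_split p) dilS_kill; last exact: ple_refl.
apply: addr_ge0; first by apply: IH; case: st.
rewrite /= lower_id; last exact: ple_refl.
have : ple P (lower p (q, k)).1 p by exact: meetr.
case: (lower p (q, k)) => m k' /= mp.
move: [seq _ | x <- t] (size_map (lower p) t) => t' st'.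
have {}st' : size t' = n by rewrite st'; case: st.
rewrite (dilS_split m); apply: addr_ge0.
  rewrite (@dilS_perm _ _ ((m, k') :: (p, h) :: t')); last first.
    by rewrite (perm_catCA [:: (p, h)] [:: (m, k')]).
  by rewrite dilS_kill; [exact: IH|exact: ple_refl].
rewrite /= [lower _ (m, k')]lower_id; last exact: ple_refl.
have -> : lower m (p, h) = (m, N (m^-1 * p) h) by rewrite /lower /= meetC meet_ple.
by rewrite dilS_merge; apply: IH; rewrite size_map.
Qed.

Lemma dilk_pos (s : seq (R[i] * (G * K))) : (0 <= kform dilk s s)%R.
Proof.
have := dilS_ge0 [::] [seq (z.2.1, z.1 *: z.2.2)%R | z <- s].
rewrite /dilS big_map kformE; congr (_ <= _)%R; apply: eq_bigr => z _.
rewrite big_map; apply: eq_bigr => w _.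
by rewrite /dilB /dilk [N _ (z.1 *: _)%R]linearZ [N _ (w.1 *: _)%R]linearZ hdotZl hdotZr mulrA.
Qed.

Definition dil_kernel : pskernel R (G * K) := PSKernel dilkC dilk_pos.

End KernelPositivity.

(** * Regular dilations *)

Section Adjoints.
Variable R : realType.
Implicit Types H K : hilbertType R.

Lemma adjPl H K (A : 'B(H, K)) x y : '[adj A x, y] = '[x, A y].
Proof. by rewrite hdotC -adjP -hdotC. Qed.

Lemma hdot_isometric H K (V : 'B(H, K)) x y : isometric V -> '[V x, V y] = '[x, y].
Proof. by move=> iV; rewrite adjP isometric_adjK. Qed.

Definition star_commute H (A B : 'B(H)) := forall h, adj A (B h) = B (adj A h).

Lemma star_commute_sym H (A B : 'B(H)) : star_commute A B -> star_commute B A.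
Proof.
by move=> AB h; apply: hdot_ext => z; rewrite adjPl (adjP A) AB -adjPl -adjP.
Qed.

Lemma star_commute_prod H I (s : seq I) (A : 'B(H)) (B : I -> 'B(H)) :
  (forall i, star_commute A (B i)) -> star_commute A (\prod_(i <- s) B i)%g.
Proof.
move=> AB; elim: s => [|i s IH] h; first by rewrite big_nil.
by rewrite big_cons /= AB IH.
Qed.

Lemma normal_star_commute H (A : 'B(H)) : normal_op A <-> star_commute A A.
Proof. by rewrite /normal_op -bopP. Qed.

End Adjoints.

Section ShiftRepresentation.
Local Open Scope group_scope.
Variables (R : realType) (G : groupType).

Lemma unitary_representation_adj (K : hilbertType R) (U : G -> 'B(K)) g :
  unitary_representation U -> adj (U g) = U g^-1.
Proof.
move=> [[U1 UM] /(_ g)[UU _]].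
by rewrite -[LHS]mulg1 -U1 -(mulgV g) UM// mulgA UU mul1g.
Qed.

Lemma unitary_representation_norm (K : hilbertType R) (U : G -> 'B(K)) g z :
  unitary_representation U -> `|U g z| = `|z|.
Proof.
move=> [_ /(_ g)[/bopP/(_ z) /= e _]].
apply/eqP; rewrite -(eqrXn2 (ltn0Sn 1))//; apply/eqP.
by rewrite -!hdot_norm adjP e.
Qed.

(** Invariance of the kernel makes every translation contractive and identifies the adjoint of [U g]
    with [U g^-1]. *)
Lemma shift_representation L (k : pskernel R (G * L)) :
  (forall g x y, k (shift g x) (shift g y) = k x y) ->
  exists2 U : G -> 'B(rkhs k), (forall g x, U g (kvec k x) = kvec k (shift g x)) &
    unitary_representation U.
Proof.
move=> k_shift.
have /choice[U UE] g : exists A : 'B(rkhs k), forall x, A (kvec k x) = kvec k (shift g x).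
  have [s|A AE _] := @kvec_operator R _ k (shift g); last by exists A.
  rewrite kform_map (_ : (fun x y => _) = k)//.
  by apply/funext => x; apply/funext => y; exact: k_shift.
have UM g g' : U (g * g') = U g * U g'.
  by apply: bop_kvec_ext => x; rewrite /= !UE /shift /= mulgA.
have U1 : U 1 = 1.
  by apply: bop_kvec_ext => x; rewrite UE /shift /= mul1g -surjective_pairing.
have UV g : adj (U g) = U g^-1.
  apply: bop_kvec_ext => x; apply: rkhsP => y.
  rewrite -!hdot_kvec adjPl !UE !hdot_kvec2 -[in LHS](k_shift g^-1).
  by rewrite /shift /= mulKg -surjective_pairing.
exists U => //; split=> [|g]; first by split=> [|p q _ _]; [exact: U1|exact: UM].
by rewrite /unitary_op UV -!UM mulVg mulgV U1.
Qed.

End ShiftRepresentation.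

Section RegularDilation.
Local Open Scope group_scope.
Variables (R : realType) (G : groupType) (P : set G).
Hypothesis losP : lattice_ordered_semigroup P.
Variables (K : hilbertType R) (N : G -> 'B(K)).
Hypothesis abP : abelian_semigroup P.
Hypothesis repN : representation P N.
Hypothesis contrN : forall p, P p -> forall h, (`|N p h| <= `|h|)%R.
Hypothesis scN : forall p q, P p -> P q -> star_commute (N p) (N q).

Let normalN : normal_rep P N.
Proof. by move=> p Pp; apply/normal_star_commute/scN. Qed.

Let commN p q : P p -> P q -> forall h, N p (N q h) = N q (N p h).
Proof.
move=> Pp Pq; apply/(@bopP _ _ _ (N p * N q) (N q * N p)).
by rewrite -!repN.2// abP.
Qed.

Let k := dil_kernel losP repN normalN contrN commN scN.

Lemma star_commuting_regular : regular_representation P N.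
Proof.
have k_lin p c h h' y : k (p, c *: h + h')%R y = (c * k (p, h) y + k (p, h') y)%R.
  exact: (dilB_lin losP N [::]).
have k_shift g x y : k (shift g x) (shift g y) = k x y.
  exact: (dilB_shift losP N g [::]).
have k1 h h' : k (1, h) (1, h') = '[h, h'].
  rewrite /= /dilk /= meet_ple; last exact: ple_refl.
  by rewrite !(repN_id repN).
have norm_kvec h : `|kvec k (1, h)| = `|h|.
  apply/eqP; rewrite -(eqrXn2 (ltn0Sn 1))//; apply/eqP.
  by rewrite -!hdot_norm hdot_kvec2 k1.
have [|h|V VE] := @contraction_bop R K (rkhs k) (fun h => kvec k (1, h)).
- by move=> c h h'; apply: rkhsP => y; exact: k_lin.
- by rewrite norm_kvec.
have [U UE unitU] := shift_representation k_shift.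
exists (rkhs k), V, U; split.
- by move=> h; rewrite VE norm_kvec.
- exact: unitU.
move=> g gm gp [Pm Pp /(is_meet_eq losP) mpm gE]; apply/bopP => h; apply: hdot_ext => z.
(* Hence the kernel at [(g, h)] and [(1, z)] is [<N gp h, N gm z>], exactly the form required by
   regularity. *)
have m : meet losP g 1 = gm^-1.
  by rewrite gE -(mulVg gm) meet_mulg mpm mulg1.
rewrite /= adjPl [RHS]adjPl !VE UE hdot_kvec2 /= /dilk /= mulg1 m invgK mulg1.
by rewrite gE mulVKg.
Qed.
End RegularDilation.

(** * From a normal extension to regularity *)

Section Restriction.
Local Open Scope group_scope.
Variables (R : realType) (G : groupType) (P : set G).

(** Since [V] is isometric and intertwines, [<T gp h, T gm z> = <N gp V h, N gm V z>]; a dilation of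
    [N] therefore dilates [T] along [W V]. *)
Lemma regular_restrict (H K : hilbertType R) (V : 'B(H, K)) (T : G -> 'B(H)) (N : G -> 'B(K)) :
  isometric V -> (forall p, P p -> forall h, V (T p h) = N p (V h)) ->
  regular_representation P N -> regular_representation P T.
Proof.
move=> iV VT [L [W [U [iW unitU NU]]]].
exists L, (bop_comp W V), U; split=> //; first by move=> h; rewrite /= iW iV.
move=> g gm gp dec; have [Pm Pp _ _] := dec.
apply/bopP => h; apply: hdot_ext => z; rewrite /= !adjPl.
rewrite -(hdot_isometric _ _ iV) !VT// -adjPl.
have /bopP/(_ (V h)) /= -> := NU _ _ _ dec.
by rewrite adjPl.
Qed.

Lemma contractiveP (H : hilbertType R) (T : G -> 'B(H)) : contractive P T <->
  forall p, P p -> forall h, (`|T p h| <= `|h|)%R.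
Proof. by split=> h p Pp; have := h p Pp; rewrite opnorm_le1. Qed.

End Restriction.

Section NormalExtension.
Local Open Scope group_scope.
Variables (R : realType) (G : groupType) (P : set G).
Hypothesis losP : lattice_ordered_semigroup P.
Hypothesis abP : abelian_semigroup P.

(** Regularity is proved for [Tinf N] and then restricted to [H]. By Fuglede the [N p] star-commute
    pairwise, and [Tinf N] inherits this factor by factor. *)
Lemma normal_extension_regular (H K : hilbertType R) (V : 'B(H, K)) (T : G -> 'B(H))
    (N : G -> 'B(K)) :
  isometric V -> representation P N -> contractive P N -> normal_rep P N ->
  (forall p, P p -> forall h, V (T p h) = N p (V h)) ->
  regular_representation (Pinf P) (Tinf T).
Proof.
move=> iV repN /contractiveP contrN normalN VT.
apply: (regular_restrict (N := Tinf N) iV).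
  move=> f Pf h; rewrite /Tinf; elim: (enum_fset _) h => [|n s IH] h; first by rewrite !big_nil.
  by rewrite !big_cons /= VT// IH.
have scN p q : P p -> P q -> star_commute (N p) (N q).
  move=> Pp Pq; apply: fuglede => [|||h]; [exact: normalN|exact: contrN|exact: contrN|].
  by move: h; apply/(@bopP _ _ _ (N q * N p) (N p * N q)); rewrite -!repN.2// abP.
apply: (star_commuting_regular (Pinf_lattice_ordered losP)).
- exact: Pinf_abelian.
- by apply: Tinf_representation => //; exact: losM.
- move=> f Pf h; rewrite /Tinf; elim: (enum_fset _) => [|n s IH]; first by rewrite big_nil.
  by rewrite big_cons /= (le_trans (contrN _ _ _)).
- move=> f g Pf Pg; apply: star_commute_prod => n; apply: star_commute_sym.
  by apply: star_commute_prod => m; exact: scN.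
Qed.

End NormalExtension.

(** * Normal extensions *)

Section VectorKernel.
Variables (R : realType) (X : Type) (K : hilbertType R) (v : X -> K).
Local Notation C := R[i].
Implicit Types s t : seq (C * X).

Lemma hdot_family_comb s t :
  '[family_comb v s, family_comb v t] = kform (fun x y => '[v x, v y]) s t.
Proof.
rewrite kformE hdot_combl; apply: eq_bigr => p _.
by rewrite hdot_combr mulr_sumr; apply: eq_bigr => q _; rewrite mulrA.
Qed.

Lemma vector_kernel_ge0 s : 0 <= kform (fun x y => '[v x, v y]) s s.
Proof. by rewrite -hdot_family_comb hdot_norm exprn_ge0. Qed.

(** The Hilbert space of this Gram kernel plays the part of the closed span of the vectors [v x] in
    [K]. *)
Definition vector_kernel : pskernel R X :=
  PSKernel (fun x y => hdotC (v x) (v y)) vector_kernel_ge0.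

End VectorKernel.

Section FiniteSequences.
Local Open Scope group_scope.
Variables (G : groupType) (P : set G).
Hypothesis losP : lattice_ordered_semigroup P.

Lemma trivial_position (fs : seq (finseq G)) : exists n, forall f, f \in fs -> f n = 1.
Proof.
pose s := flatten [seq (finsupp f : seq nat) | f <- fs].
exists (\max_(i <- s) i).+1 => f ffs; apply: fsfun_dflt; apply/negP => nf.
suff : ((\max_(i <- s) i).+1 <= \max_(i <- s) i)%N by rewrite ltnn.
by apply: (@leq_bigmax_seq _ s xpredT id) => //; apply/flattenP; 
exists (finsupp f : seq nat) => //; exact: (map_f (fun f : finseq G => finsupp f : seq nat)).
Qed.

Lemma delta_commute (f : finseq G) r n : f n = 1 -> delta r n * f = f * delta r n.
Proof.
move=> fn; apply/fsfunP => i; rewrite !finseqME deltaE; case: eqP => [->|_].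
  by rewrite fn mulg1 mul1g.
by rewrite mulg1 mul1g.
Qed.

Lemma decomposition_delta (g gm gp : finseq G) r n : P r -> g n = 1 ->
  is_decomposition (Pinf P) g gm gp ->
  is_decomposition (Pinf P) (g * delta r n) gm (gp * delta r n).
Proof.
move=> Pr gn [Pm Pp [_ _ inf1] gE]; have P1 := los1 losP.
have Pd := delta_Pinf P1 n Pr.
have gpm : gp n = gm n.
  have := congr1 (fun f : finseq G => gm n * f n) gE.
  by rewrite /= gn mulg1 finseqME finseqVE mulVKg.
have gpn : gp n = 1.
  apply: (los_pointed losP) => //.
  (* As [gp n = gm n], this sequence is a common lower bound of [gp] and [gm], whose meet is 1;
     pointedness then forces [gp n = 1]. *)
  have : ple (Pinf P) (delta (gp n) n) 1.
    apply: inf1 => i; rewrite finseqME finseqVE deltaE; case: eqP => [->|_];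
      by rewrite ?invg1 ?mul1g ?gpm ?mulVg.
  by move=> /(_ n); rewrite finseqME finseqVE deltaE eqxx finseq1E mulg1.
have gmn : gm n = 1 by rewrite -gpm.
split=> //; last by rewrite gE mulgA.
  by move=> i; rewrite finseqME; apply: (losM losP); [exact: Pp|exact: Pd].
split=> [i|i|w wp wm].
- by rewrite invg1 mul1g finseqME; apply: (losM losP); [exact: Pp|exact: Pd].
- by rewrite invg1 mul1g.
apply: inf1 => // i; have := wp i; have := wm i; rewrite !finseqME finseqVE deltaE.
by case: eqP => [->|_]; rewrite ?mulg1// gmn gpn.
Qed.

End FiniteSequences.

Section RegularToNormal.
Local Open Scope group_scope.
Variables (R : realType) (G : groupType) (P : set G).
Hypothesis losP : lattice_ordered_semigroup P.
Hypothesis abP : abelian_semigroup P.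
Variables (H : hilbertType R) (T : G -> 'B(H)).
Hypothesis repT : representation P T.
Variables (K : hilbertType R) (V : 'B(H, K)) (U : finseq G -> 'B(K)).
Hypotheses (iV : isometric V) (unitU : unitary_representation U).
Hypothesis dilU : forall g gm gp, is_decomposition (Pinf P) g gm gp ->
  adj (Tinf T gm) * Tinf T gp = compression V (U g).
Implicit Types (r p q : G) (n : nat).
Local Notation X := (finseq G * H)%type.
Implicit Types x y : X.

Definition orbit_vector x := U x.1 (V x.2).

Let k := vector_kernel orbit_vector.

Definition slide r x : X := (x.1, T r x.2).

Lemma hdot_orbit x y :
  '[orbit_vector x, orbit_vector y] = '[U (y.1^-1 * x.1) (V x.2), V y.2].
Proof.
by rewrite unitU.1.2// /= -(unitary_representation_adj _ unitU) adjPl.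
Qed.

(* On the orbit vectors, [U (delta r n)] acts as [slide r] does, weakly and for [n]
   large: the position [n] has to avoid the supports of the sequences involved. *)
Lemma dilation_delta r n (g : finseq G) (h h' : H) : P r -> g n = 1 ->
  '[U (g * delta r n) (V h), V h'] = '[U g (V (T r h)), V h'].
Proof.
move=> Pr gn; have Plos := Pinf_lattice_ordered losP.
have [gm [gp dec]] := decomposition_exists Plos g.
have dec' := decomposition_delta losP Pr gn dec.
have [_ Pp _ _] := dec.
have dilE f fm fp z z' : is_decomposition (Pinf P) f fm fp ->
    '[U f (V z), V z'] = '[Tinf T fp z, Tinf T fm z'].
  move=> /dilU/bopP/(_ z) /= e; rewrite -[LHS]adjPl -e adjPl; exact: erefl.
have TM := Tinf_representation (losM losP) abP repT.
have Pd := delta_Pinf (los1 losP) n Pr.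
rewrite (dilE _ _ _ _ _ dec') (dilE _ _ _ _ _ dec) (TM.2 _ _ Pp Pd).
by rewrite /= (Tinf_delta (los1 losP) _ repT).
Qed.

Lemma orbit_delta r n x y : P r -> x.1 n = 1 -> y.1 n = 1 ->
  '[U (delta r n) (orbit_vector x), orbit_vector y] = k (slide r x) y.
Proof.
move=> Pr xn yn; rewrite /orbit_vector /k /= hdot_orbit /=.
have -> : U (delta r n) (U x.1 (V x.2)) = orbit_vector (delta r n * x.1, x.2).
  by rewrite /orbit_vector unitU.1.2.
rewrite hdot_orbit /= delta_commute// mulgA dilation_delta//.
by rewrite finseqME finseqVE xn yn invg1 mul1g.
Qed.


(** For [n] outside all supports, [<U (delta r n) u, w> = <w, w>]; as [U (delta r n)] is unitary,
    [|w|^2 <= |u| |w|]. *)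
Lemma kform_slide r (s : seq (R[i] * X)) : P r ->
  (kform k (map_comb (slide r) s) (map_comb (slide r) s) <= kform k s s)%R.
Proof.
move=> Pr; have [n sn] := trivial_position [seq z.2.1 | z <- s].
pose u := family_comb orbit_vector s.
pose w := family_comb orbit_vector (map_comb (slide r) s).
rewrite -!hdot_family_comb -/u -/w !hdot_norm.
suff uw : '[U (delta r n) u, w] = '[w, w].
  rewrite ler_sqr ?nnegrE//; apply: le_of_sqr => //.
  rewrite -hdot_norm -uw -(unitary_representation_norm (delta r n) u unitU).
  rewrite -[leLHS]ger0_norm; first exact: hdot_bound.
  by rewrite uw hdot_norm exprn_ge0.
rewrite [RHS]hdot_family_comb kform_map kformE bop_family_comb.
rewrite hdot_combl; apply: eq_big_seq => z zs.
rewrite /w hdot_combr big_map mulr_sumr; apply: eq_big_seq => z' zs' /=.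
by rewrite mulrA orbit_delta//= sn//; exact: (map_f (fun z => z.2.1)).
Qed.

Lemma normal_extension_of_regular :
  exists (L : hilbertType R) (W : 'B(H, L)) (N : G -> 'B(L)),
     [/\ isometric W, representation P N, contractive P N, normal_rep P N &
         forall p, P p -> forall h : H, W (T p h) = N p (W h)].
Proof.
have k_shift (g : finseq G) x y : k (shift g x) (shift g y) = k x y.
  rewrite /k /= !hdot_orbit /= invgM -!mulgA mulKg; exact: erefl.
have [S SE unitS] := shift_representation k_shift.
have /choice[N NE] r : exists A : 'B(rkhs k), P r ->
    (forall x, A (kvec k x) = kvec k (slide r x)) /\ forall f, (`|A f| <= `|f|)%R.
  have [Pr|nPr] := pselect (P r); last by exists 1.
  by have [s|A AE A1] := @kvec_operator R _ k (slide r); [exact: kform_slide|exists A].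
have k1 h h' : k (1, h) (1, h') = '[h, h'].
  by rewrite /k /= !hdot_orbit /= mulVg unitU.1.1 (hdot_isometric _ _ iV).
have norm_kvec h : `|kvec k (1, h)| = `|h|.
  apply/eqP; rewrite -(eqrXn2 (ltn0Sn 1))//; apply/eqP.
  by rewrite -!hdot_norm hdot_kvec2 k1.
have [|h|W WE] := @contraction_bop R H (rkhs k) (fun h => kvec k (1, h)).
- move=> c h h'; apply: rkhsP => y.
  by rewrite /= /orbit_vector /= !linearP hdotDl hdotZl.
- by rewrite norm_kvec.
have k_delta r n x y : P r -> x.1 n = 1 -> y.1 n = 1 ->
    k (shift (delta r n) x) y = k (slide r x) y.
  move=> Pr xn yn; rewrite -(orbit_delta Pr xn yn) /k /= /orbit_vector /=.
  by rewrite unitU.1.2.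
exists (rkhs k), W, N; split.
- by move=> h; rewrite WE norm_kvec.
- split=> [|p q Pp Pq]; apply: bop_kvec_ext => x.
    by rewrite (NE 1 (los1 losP)).1 /slide repT.1 -surjective_pairing.
  rewrite /= (NE _ (losM losP Pp Pq)).1 (NE _ Pq).1 (NE _ Pp).1 /slide /=.
  by rewrite repT.2.
- by apply/contractiveP => p /NE[].
- move=> r Pr; have [Nk N1] := NE r Pr.
  (* [N r] is the weak limit of the unitaries [S (delta r n)], with which it
     commutes, so it also commutes with its adjoint. *)
  have NS g f : N r (S g f) = S g (N r f).
    suff /bopP : N r * S g = S g * N r by apply.
    by apply: bop_kvec_ext => x; rewrite /= Nk !SE Nk.
  apply/normal_star_commute => f.
  suff /bopP : adj (N r) * N r = N r * adj (N r) by apply.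
  apply: bop_kvec_ext => x; apply: rkhsP => y.
  rewrite -!hdot_kvec /= adjPl !Nk hdot_kvec2.
  set w := adj (N r) (kvec k x); symmetry.
  (* The vector [w] need not be a finite combination, so it is replaced by one, [vcomb k s], within
     [d]. Against [kvec k y], [N r] and [D] agree on that combination, and each contributes an error
     of at most [d] times the norm of [kvec k y]. *)
  apply: (@eq_of_small _ _ _ (2 * `|kvec k y|)%R) => d d0 _.
  have [s sw] := vcomb_dense w d0.
  have [n sn] := trivial_position [:: x.1, y.1 & [seq z.2.1 | z <- s]].
  have xn : x.1 n = 1 by apply: sn; rewrite inE eqxx.
  have yn : y.1 n = 1 by apply: sn; rewrite !inE eqxx orbT.
  pose D := S (delta r n).
  (* This value is exact: the adjoint of [D] is again in the group, so [N r] commutes with it and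
     can be moved onto [kvec k y]. *)
  have Dw : '[D w, kvec k y] = k (slide r x) (slide r y).
    rewrite /D adjP (unitary_representation_adj _ unitS) /w adjPl NS Nk.
    rewrite -(unitary_representation_adj _ unitS) -adjP SE hdot_kvec2.
    exact: k_delta.
  have Ds : '[N r (vcomb k s), kvec k y] = '[D (vcomb k s), kvec k y].
    rewrite /vcomb !bop_family_comb !hdot_combl; apply: eq_big_seq => z zs.
    rewrite Nk SE !hdot_kvec2 k_delta// sn//.
    by rewrite !inE; apply/orP; right; apply/orP; right; exact: (map_f (fun z => z.2.1)).
  rewrite -Dw (_ : _ - _ = '[N r (w - vcomb k s), kvec k y] - '[D (w - vcomb k s), kvec k y])%R.
    apply: le_trans (ler_normB _ _) _; rewrite -mulrA mulr_natl mulr2n.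
    apply: lerD; apply: le_trans (hdot_bound _ _) _; rewrite mulrC ler_wpM2l//.
      exact: le_trans (N1 _) sw.
    by rewrite (unitary_representation_norm _ _ unitS).
  by rewrite (linearB (N r)) (linearB D) !hdotBl Ds opprB addrA subrK.
- by move=> p /NE[Np _] h; rewrite !WE Np.
Qed.

End RegularToNormal.

Theorem theorem3p5 (R : realType) (G : groupType) (P : set G)
    (H : hilbertType R) (T : G -> 'B(H)) :
  lattice_ordered_semigroup P -> abelian_semigroup P ->
  representation P T -> contractive P T ->
  (exists (K : hilbertType R) (V : 'B(H, K)) (N : G -> 'B(K)),
     [/\ isometric V, representation P N, contractive P N, normal_rep P N &
         forall p, P p -> forall h : H, V (T p h) = N p (V h)])
  <-> regular_representation (Pinf P) (Tinf T).
Proof.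
move=> losP abP repT _; split=> [[K [V [N [iV repN contrN normalN VT]]]]|].
  exact (normal_extension_regular losP abP iV repN contrN normalN VT).
move=> [K [V [U [iV unitU dilU]]]].
exact (normal_extension_of_regular losP abP repT iV unitU dilU).
Qed.
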